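(* Let $\hat{\Phi}$ be a formal real equivalence between two germs of reduced formal complex curves $\mathscr{C}$ and $\mathscr{C}'$ at $(\mathbb{C}^2,0)$. Then $\mathscr{C}$ and $\mathscr{C}'$ are equisingular.
   Context: A formal parametrized real surface at $(\mathbb{C}^2,0)$ is a nonzero formal series $\sum a_{jk}x^jy^k$ in two real variables, with $a_{jk}\in\mathbb{C}^2$ and no constant term. A formal parametrized complex curve $\sum_{j\ge1}\alpha_jz^j$ ($\alpha_j\in\mathbb{C}^2$) is regarded as a formal parametrized real surface via $z=x+iy$. A formal real reparametrization of such a surface is any series obtained by the substitution $(x,y)=\Psi(\bar x,\bar y)$ with $\Psi$ a formal diffeomorphism of $(\mathbb{R}^2,0)$. Let $\hat\Phi$ be a formal diffeomorphism of $(\mathbb{R}^4,0)$, where $\mathbb{R}^4\simeq\mathbb{C}^2$. Given two formal parametrized irreducible complex curves $\sigma(z)=\sum_{j\ge 1}\sigma_jz^j$ and $\sigma'(z)=\sum_{j\ge 1}\sigma'_jz^j$ at $(\mathbb{C}^2,0)$, where the parametrizations are irreducible (not of the form $\tilde\Gamma(\varphi(z))$ with $\mathrm{ord}(\varphi)>1$), $\hat\Phi$ is a formal real equivalence between $\sigma$ and $\sigma'$ if $\hat\Phi\circ\sigma$ is a formal real reparametrization of $\sigma'$. In general, $\hat\Phi$ is a formal real equivalence between two reduced formal complex curves $\mathscr{C}$ and $\mathscr{C}'$ at $(\mathbb{C}^2,0)$ if there is a bijection between the irreducible components of $\mathscr{C}$ and those of $\mathscr{C}'$ such that each pair of corresponding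 components is formally real equivalent by $\hat\Phi$. Two reduced formal complex curves at $(\mathbb{C}^2,0)$ are equisingular if their (minimal) desingularizations by blow-ups are combinatorially isomorphic (in the sense of Zariski). *)

(* Defs.v *)
From HB Require Import structures.
From mathcomp Require Import all_boot all_order all_algebra.
From mathcomp Require Import complex reals.
From mathcomp Require Import mpoly.

Set Implicit Arguments.
Unset Strict Implicit.
Unset Printing Implicit Defensive.

Import GRing.Theory Num.Theory.
Local Open Scope ring_scope.

(** * Formal power series and formal maps *)

(* A formal power series in [n] variables is its family of coefficients. *)
Definition fps (K : Type) (n : nat) := 'X_{1..n} -> K.

(* [m] series in [n] variables, i.e. a formal map from n-space to m-space. *)
Definition fmap (K : Type) (m n : nat) := 'I_m -> fps K n.

Section Series.
Variable K : comNzRingType.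

Definition fps_of_mpoly n (p : {mpoly K[n]}) : fps K n := fun m => p@_m.

Definition trunc n (d : nat) (f : fps K n) : {mpoly K[n]} :=
  \sum_(m : 'X_{1..n < d.+1}) f m *: 'X_[m].

Definition fps_mul n (f g : fps K n) : fps K n :=
  fun m => (trunc (mdeg m) f * trunc (mdeg m) g)@_m.

(* Meaningful when [G] has no constant term: terms of degree above [mdeg m]
   in [f] or [G] then do not contribute to the coefficient at [m]. *)
Definition fps_subst m n (f : fps K m) (G : fmap K m n) : fps K n :=
  fun a => (trunc (mdeg a) f \mPo [tuple trunc (mdeg a) (G i) | i < m])@_a.

Definition fcomp l m n (F : fmap K l m) (G : fmap K m n) : fmap K l n :=
  fun i => fps_subst (F i) G.

Definition centered m n (F : fmap K m n) : Prop := forall i, F i 0%MM = 0.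

Definition jacobian m n (F : fmap K m n) : 'M[K]_(m, n) :=
  \matrix_(i, j) F i U_(j)%MM.

End Series.

Definition formal_diffeo (K : fieldType) n (F : fmap K n n) : Prop :=
  centered F /\ jacobian F \in unitmx.

(** * Formal complex curves at the origin of the plane *)

Section Curves.
Variable K : fieldType.

Definition param_curve (s : fmap K 2 1) : Prop :=
  centered s /\ ~ (s =2 fun _ _ => 0).

Definition irreducible_param (s : fmap K 2 1) : Prop :=
  param_curve s /\
  ~ exists (G : fmap K 2 1) (phi : fmap K 1 1),
      [/\ param_curve G,
          forall i m, (mdeg m <= 1)%N -> phi i m = 0
        & s =2 fcomp G phi].

Definition same_branch (s t : fmap K 2 1) : Prop :=
  exists phi : fmap K 1 1, formal_diffeo phi /\ t =2 fcomp s phi.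

(* [f = 0] is an equation of a reduced curve at the origin: [f] is nonzero,
   vanishes at 0, and the square of a non-unit does not divide it. *)
Definition reduced_curve (f : fps K 2) : Prop :=
  [/\ f 0%MM = 0, ~ (f =1 fun _ => 0)
    & forall g h : fps K 2, f =1 fps_mul (fps_mul g g) h -> g 0%MM != 0].

(* [C] lists the irreducible components of the curve [f = 0], each exactly
   once, every component being given by an irreducible parametrization. *)
Definition components (f : fps K 2) r (C : 'I_r -> fmap K 2 1) : Prop :=
  [/\ forall i, irreducible_param (C i) /\ fps_subst f (C i) =1 (fun _ => 0),
      forall i j, same_branch (C i) (C j) -> i = j
    & forall s, irreducible_param s -> fps_subst f s =1 (fun _ => 0) ->
        exists i, same_branch (C i) s].

(** * Desingularization by point blow-ups *)

(* A point of the exceptional line of the blow-up of a point: [Some c] is the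
   direction [y = c x], [None] is the direction [x = 0]. *)
Definition direction := option K.

(* The blow-down map in coordinates [(u, v)] centred at the point [d] of the
   exceptional line: [(u, v) |-> (u, u (c + v))], resp. [(u v, v)]. *)
Definition chart (d : direction) : fmap K 2 2 := fun k =>
  let u : {mpoly K[2]} := 'X_0 in
  let v : {mpoly K[2]} := 'X_1 in
  fps_of_mpoly
    match d with
    | Some c => if k == 0 then u else u * (c%:MP + v)
    | None => if k == 0 then u * v else v
    end.

(* The exceptional line in these coordinates: [u = 0], resp. [v = 0]. *)
Definition exc_line (d : direction) : fmap K 2 1 := fun k =>
  let z : {mpoly K[1]} := 'X_0 in
  fps_of_mpoly
    match d with
    | Some _ => if k == 0 then 0 else z
    | None => if k == 0 then z else 0
    end.

(* Points infinitely near to the origin: [d1; ...; dn] is the point [dn] of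
   the exceptional line of the blow-up at [d1; ...; d(n-1)].  The empty
   sequence is the origin itself. *)
Definition inf_near := seq direction.

(* A curve parametrized in the coordinates at [p], read at the origin. *)
Definition blowdown (p : inf_near) (t : fmap K 2 1) : fmap K 2 1 :=
  foldr (fun d s => fcomp (chart d) s) t p.

(* Components of the total transform of a curve with [r] branches: strict
   transforms of its branches, and exceptional divisors, [Exc q] being the one
   created by blowing up [q]. *)
Inductive divisor (r : nat) := Branch of 'I_r | Exc of inf_near.

Section TotalTransform.
Variables (r : nat) (C : 'I_r -> fmap K 2 1).

(* [t] parametrizes the germ at [p] of the strict transform of [A], all the
   points of which [p] is an infinitely near point having been blown up.  The
   strict transform of a parametrized curve is its lift by the blow-downs. *)
Definition germ_at (A : divisor r) (p : inf_near) (t : fmap K 2 1) : Prop :=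
  centered t /\
  match A with
  | Branch i => blowdown p t =2 C i
  | Exc q => exists d s, p = q ++ d :: s /\ blowdown s t =2 exc_line d
  end.

Definition passes (A : divisor r) (p : inf_near) : Prop :=
  exists t, germ_at A p t.

Definition normal_crossings (p : inf_near) : Prop :=
  [/\ forall A t, germ_at A p t -> jacobian t != 0,
      forall A B t t', A <> B -> germ_at A p t -> germ_at B p t' ->
        \det (row_mx (jacobian t) (jacobian t') : 'M_2) != 0
    & forall A B D, passes A p -> passes B p -> passes D p ->
        [\/ A = B, A = D | B = D]].

(* The centres of the minimal desingularization: starting from the origin,
   one blows up exactly the points where the total transform does not have
   normal crossings. *)
Definition centre (p : inf_near) : Prop :=
  forall q, prefix q p -> ~ normal_crossings q.

(* Points of the desingularized surface (lying over the origin). *)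
Definition final_point (p : inf_near) : Prop :=
  ~ centre p /\ forall q, prefix q p -> q != p -> centre q.

Definition in_desing (A : divisor r) : Prop :=
  if A is Exc q then centre q else True.

Definition meet (A B : divisor r) : Prop :=
  exists p, [/\ final_point p, passes A p & passes B p].

End TotalTransform.

Definition map_divisor r r' (b : 'I_r -> 'I_r') (k : inf_near -> inf_near)
    (A : divisor r) : divisor r' :=
  match A with Branch i => Branch (b i) | Exc q => Exc r' (k q) end.

(* A combinatorial isomorphism of the minimal desingularizations: a bijection
   [b] between the branches and a bijection [k] between the centres (hence
   between the exceptional divisors), compatible with the infinitely near
   order, with the divisors and branches going through each centre, and with
   incidence in the desingularized surface.  The self-intersection of [Exc q]
   is -1 minus the number of centres it passes through, so [b] and [k] also
   give an isomorphism of weighted dual graphs. *)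
Definition combinatorially_isomorphic r (C : 'I_r -> fmap K 2 1)
    r' (C' : 'I_r' -> fmap K 2 1) : Prop :=
  exists (b : 'I_r -> 'I_r') (k : inf_near -> inf_near),
    [/\ bijective b,
        [/\ forall p, centre C p -> centre C' (k p),
            forall p q, centre C p -> centre C q -> k p = k q -> p = q
          & forall p', centre C' p' -> exists2 p, centre C p & k p = p'],
        forall p q, centre C p -> centre C q ->
          prefix (k q) (k p) = prefix q p,
        forall A p, in_desing C A -> centre C p ->
          passes C A p <-> passes C' (map_divisor b k A) (k p)
      & forall A B, in_desing C A -> in_desing C B ->
          meet C A B <-> meet C' (map_divisor b k A) (map_divisor b k B)].

Definition equisingular (f f' : fps K 2) : Prop :=
  exists r (C : 'I_r -> fmap K 2 1) r' (C' : 'I_r' -> fmap K 2 1),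
    [/\ components f C, components f' C' & combinatorially_isomorphic C C'].

End Curves.

(** * Formal real equivalence *)

Section RealEquivalence.
Variable R : realType.

(* C^2 is identified with R^4 by (x1 + i y1, x2 + i y2) |-> (x1, x2, y1, y2). *)
Definition realify n (S : fmap R[i] 2 n) : fmap R 4 n := fun k m =>
  match split (k : 'I_(2 + 2)) with
  | inl j => complex.Re (S j m)
  | inr j => complex.Im (S j m)
  end.

Definition x_plus_iy : fmap R[i] 1 2 := fun _ =>
  fps_of_mpoly ('X_0 + 'i%C *: 'X_1).

(* The formal real surface in R^4 underlying a parametrized complex curve. *)
Definition real_surface (s : fmap R[i] 2 1) : fmap R 4 2 :=
  realify (fcomp s x_plus_iy).

Definition real_reparam (S S' : fmap R 4 2) : Prop :=
  exists Psi : fmap R 2 2, formal_diffeo Psi /\ S' =2 fcomp S Psi.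

Definition real_equiv_param (Phi : fmap R 4 4) (s s' : fmap R[i] 2 1) : Prop :=
  real_reparam (real_surface s') (fcomp Phi (real_surface s)).

Definition formal_real_equivalence (Phi : fmap R 4 4) (f f' : fps R[i] 2) :
    Prop :=
  exists r (C : 'I_r -> fmap R[i] 2 1) r' (C' : 'I_r' -> fmap R[i] 2 1)
         (b : 'I_r -> 'I_r'),
    [/\ components f C, components f' C', bijective b
      & forall i, real_equiv_param Phi (C i) (C' (b i))].

End RealEquivalence.

(* Main.v *)
Require Import Defs.
From HB Require Import structures.
From mathcomp Require Import all_boot all_order all_algebra.
From mathcomp Require Import boolp complex reals.
From mathcomp Require Import mpoly ring.

Set Implicit Arguments.
Unset Strict Implicit.
Unset Printing Implicit Defensive.

Import GRing.Theory Num.Theory.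
Local Open Scope ring_scope.

(** Replace the real coordinates [(x, y)] of a surface by [z = x + i y] and
    [w = x - i y], regarded as independent variables. The surface underlying a
    branch [s] becomes the product [(z, w) |-> (s(z), t(w))], where [t] has the
    coefficients conjugate to those of [s], and the real equivalence becomes a
    formal diffeomorphism [Phi] of complex 4-space carrying these products to
    one another, up to diffeomorphisms [Psi_i] of the [(z, w)]-plane
    ([complexify_equivalence]). It remains to compare the branches [C_i] and
    [C'_i] of the two curves, and there are two cases.

    Suppose that some branch [C_i] is singular. Every function of
    [(C_i(z), t(w))] then has a vanishing [w]-derivative along [w = 0], and by
    the chain rule [Psi_i] maps the axis [w = 0] into an axis
    ([diffeo_preserves_axes]). So one of the two halves of [Phi(., 0)] is
    constant along [C_i]. As no smooth curve contains a singular branch, the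
    linear part of this half vanishes, and that of the other half is
    invertible. This other half is a formal diffeomorphism of the complex
    plane; setting [w = 0] in all the equivalences, one sees that it maps every
    [C_j] onto [C'_j], or every [C_j] onto the conjugate of [C'_j]
    ([singular_component]). Formal diffeomorphisms lift to blow-ups
    ([lift_exists]) and coefficients can be conjugated in every chart, so both
    operations act on infinitely near points ([formal_equivalence_tree_iso],
    [conjugation_tree_iso]).

    Suppose that all branches are smooth. The order of contact of [C_i] and
    [C_j] is also that of the corresponding product surfaces, and is therefore
    preserved by [Phi] ([prod_equivalence_contact]). In suitable coordinates the
    branches are graphs, and the points infinitely near to the origin on a graph
    are given by its Taylor coefficients: the orders of contact say which
    branches share which points. A permutation of the directions at each node of
    the tree of infinitely near points then matches the two configurations
    ([same_contact_tree_iso]).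

    In both cases one gets a bijection of the whole tree of infinitely near
    points that respects the divisors passing through each point and the normal
    crossings, which is more than a combinatorial isomorphism of the minimal
    desingularizations ([tree_iso_combinatorial]).

    The calculus of formal series rests on congruences: a composite of series is
    congruent to the composite of their truncations, which yields its algebraic
    laws from those of polynomials, and inverses are fixed points of operators
    that gain one order of contact ([contraction_fixpoint]). *)

(** * Truncation *)

Section Truncation.
Variable K : comNzRingType.
Implicit Types d : nat.

Definition agree n d (p q : {mpoly K[n]}) : Prop :=
  forall m, (mdeg m <= d)%N -> p@_m = q@_m.

Lemma agree_sym n d (p q : {mpoly K[n]}) : agree d p q -> agree d q p.
Proof. by move=> h m hm; rewrite h. Qed.

Lemma agree_trans n d (q p r : {mpoly K[n]}) :
  agree d p q -> agree d q r -> agree d p r.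
Proof. by move=> h h' m hm; rewrite h // h'. Qed.

Lemma agreeD n d (p p' q q' : {mpoly K[n]}) :
  agree d p p' -> agree d q q' -> agree d (p + q) (p' + q').
Proof. by move=> h h' m hm; rewrite !mcoeffD h // h'. Qed.

Lemma agreeM n d (p p' q q' : {mpoly K[n]}) :
  agree d p p' -> agree d q q' -> agree d (p * q) (p' * q').
Proof.
move=> h h' m hm; rewrite !mcoeffM; apply: eq_bigr => k /eqP mE.
rewrite mE mdegD in hm.
by rewrite h ?h' // (leq_trans _ hm) ?leq_addl ?leq_addr.
Qed.

Lemma agreeX n d (p p' : {mpoly K[n]}) k :
  agree d p p' -> agree d (p ^+ k) (p' ^+ k).
Proof. by move=> h; elim: k => // k IH; rewrite !exprS; apply: agreeM. Qed.

Lemma agreeZ n d c (p p' : {mpoly K[n]}) :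
  agree d p p' -> agree d (c *: p) (c *: p').
Proof. by move=> h m hm; rewrite !mcoeffZ h. Qed.

Lemma agree_sum n d (I : Type) (r : seq I) (P : pred I)
    (F G : I -> {mpoly K[n]}) :
  (forall i, P i -> agree d (F i) (G i)) ->
  agree d (\sum_(i <- r | P i) F i) (\sum_(i <- r | P i) G i).
Proof. by move=> h; elim/big_rec2: _ => // i x y Pi; apply: agreeD; exact: h. Qed.

Lemma agree_prod n d (I : Type) (r : seq I) (P : pred I)
    (F G : I -> {mpoly K[n]}) :
  (forall i, P i -> agree d (F i) (G i)) ->
  agree d (\prod_(i <- r | P i) F i) (\prod_(i <- r | P i) G i).
Proof. by move=> h; elim/big_rec2: _ => // i x y Pi; apply: agreeM; exact: h. Qed.

Definition order_ge n d (p : {mpoly K[n]}) : Prop :=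
  forall m, (mdeg m < d)%N -> p@_m = 0.

Lemma order_geM n a b (p q : {mpoly K[n]}) :
  order_ge a p -> order_ge b q -> order_ge (a + b) (p * q).
Proof.
move=> h h' m hm; rewrite mcoeffM big1 // => k /eqP mE.
rewrite mE mdegD in hm; case: (ltnP (mdeg k.1) a) => h1.
  by rewrite h // mul0r.
rewrite h' ?mulr0 //; rewrite -(ltn_add2l (mdeg k.1)).
by apply: leq_trans hm _; rewrite leq_add2r.
Qed.

Lemma order_geX n (p : {mpoly K[n]}) k : order_ge 1 p -> order_ge k (p ^+ k).
Proof. by move=> h; elim: k => // k IH; rewrite exprS; apply: (order_geM h). Qed.

Lemma order_ge_prod n (I : Type) (r : seq I) (F : I -> {mpoly K[n]})
    (a : I -> nat) :
  (forall i, order_ge (a i) (F i)) ->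
  order_ge (\sum_(i <- r) a i) (\prod_(i <- r) F i).
Proof. by move=> h; elim/big_rec2: _ => // i x y _; apply: order_geM. Qed.

Lemma order_ge1 n (p : {mpoly K[n]}) : p@_0%MM = 0 -> order_ge 1 p.
Proof. by move=> h m; rewrite ltnS leqn0 mdeg_eq0 => /eqP ->. Qed.

(** Without constant terms in [Q'], a monomial of degree [e] is mapped to a
    series of order at least [e], so that the terms of high degree of [p] do not
    contribute. *)
Lemma agree_comp n k d (p p' : {mpoly K[n]}) (Q Q' : n.-tuple {mpoly K[k]}) :
  agree d p p' -> (forall i, agree d (tnth Q i) (tnth Q' i)) ->
  (forall i, (tnth Q' i)@_0%MM = 0) -> agree d (p \mPo Q) (p' \mPo Q').
Proof.
move=> hp hQ hQ0; apply: (@agree_trans _ _ (p \mPo Q')).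
  rewrite !comp_mpolyEX; apply: agree_sum => m _; rewrite !comp_mpolyX.
  by apply/agreeZ/agree_prod => i _; apply: agreeX.
pose w := maxn (msize p) (msize p').
rewrite !(comp_mpolywE _ (w := w)) ?leq_maxl ?leq_maxr //.
apply: agree_sum => m _; case: (leqP (mdeg m) d) => hm.
  by rewrite hp.
move=> a ha; rewrite !mcoeffZ (_ : _@_a = 0) ?mulr0 //.
have: order_ge (mdeg m) (\prod_(i < n) tnth Q' i ^+ m i).
  rewrite mdegE; apply: order_ge_prod => i; exact/order_geX/order_ge1.
by apply; apply: leq_ltn_trans hm.
Qed.

Lemma mcoeff_trunc n d (f : fps K n) m :
  (mdeg m <= d)%N -> (trunc d f)@_m = f m.
Proof. by move=> h; rewrite /trunc mcoeff_mpoly. Qed.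

Lemma agree_trunc n d d' (f : fps K n) :
  (d <= d')%N -> agree d (trunc d f) (trunc d' f).
Proof.
by move=> h m hm; rewrite !mcoeff_trunc // (leq_trans hm).
Qed.

Definition vanish n d (f : fps K n) := forall a, (mdeg a < d)%N -> f a = 0.

Lemma trunc_order_ge n d e (f : fps K n) : vanish d f -> order_ge d (trunc e f).
Proof.
move=> hf a ha; case: (leqP (mdeg a) e) => hae; first by rewrite mcoeff_trunc // hf.
rewrite /trunc raddf_sum big1 // => [[b /= hb]] _.
rewrite mcoeffZ mcoeffX; case: eqP => [ba|]; last by rewrite mulr0.
by move: hae; rewrite ltnNge -ba -ltnS hb.
Qed.

End Truncation.

(** * The ring of power series *)

HB.instance Definition _ (K : comNzRingType) n := gen_eqMixin (fps K n).
HB.instance Definition _ (K : comNzRingType) n := gen_choiceMixin (fps K n).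

Section Ring.
Variables (K : comNzRingType) (n : nat).
Implicit Types f g h : fps K n.

Lemma fpsP f g : f =1 g -> f = g.
Proof. exact: funext. Qed.

Definition fps_add f g : fps K n := fun m => f m + g m.
Definition fps_opp f : fps K n := fun m => - f m.
Definition fps_zero : fps K n := fun _ => 0.
Definition fps_one : fps K n := fps_of_mpoly 1.

Let addA : associative fps_add.
Proof. by move=> f g h; apply: fpsP => m; rewrite /fps_add addrA. Qed.
Let addC : commutative fps_add.
Proof. by move=> f g; apply: fpsP => m; rewrite /fps_add addrC. Qed.
Let add0 : left_id fps_zero fps_add.
Proof. by move=> f; apply: fpsP => m; rewrite /fps_add add0r. Qed.
Let addN : left_inverse fps_zero fps_opp fps_add.
Proof. by move=> f; apply: fpsP => m; rewrite /fps_add addNr. Qed.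

HB.instance Definition _ :=
  GRing.isZmodule.Build (fps K n) addA addC add0 addN.

Lemma coeffsD f g m : (f + g) m = f m + g m. Proof. by []. Qed.
Lemma coeffsN f m : (- f) m = - f m. Proof. by []. Qed.
Lemma coeffsB f g m : (f - g) m = f m - g m. Proof. by []. Qed.
Lemma coeffs0 m : (0 : fps K n) m = 0. Proof. by []. Qed.

Lemma coeffs_sum I (r : seq I) (F : I -> fps K n) m :
  (\sum_(i <- r) F i) m = \sum_(i <- r) F i m.
Proof. by elim/big_rec2: _ => // i x y _ <-. Qed.

Lemma trunc_add d f g : trunc d (f + g) = trunc d f + trunc d g.
Proof.
by rewrite /trunc -big_split; apply: eq_bigr => m _; exact: scalerDl.
Qed.

Lemma agree_trunc_mul d f g :
  agree d (trunc d (fps_mul f g)) (trunc d f * trunc d g).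
Proof.
move=> m hm; rewrite mcoeff_trunc // /fps_mul.
by apply: (agreeM _ _) (leqnn _); apply: agree_trunc.
Qed.

Lemma agree_trunc_poly d (p : {mpoly K[n]}) : agree d (trunc d (fps_of_mpoly p)) p.
Proof. by move=> m hm; rewrite mcoeff_trunc. Qed.

Let mulA : associative (@fps_mul K n).
Proof.
move=> f g h; apply: fpsP => m; rewrite {1 3}/fps_mul.
set d := mdeg m; transitivity (trunc d f * (trunc d g * trunc d h))@_m.
  by apply: (agreeM _ _) (leqnn _) => //; apply: agree_trunc_mul.
rewrite mulrA; apply: agree_sym (leqnn _); apply: agreeM => //.
exact: agree_trunc_mul.
Qed.
Let mulC : commutative (@fps_mul K n).
Proof. by move=> f g; apply: fpsP => m; rewrite /fps_mul mulrC. Qed.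
Let mul1 : left_id fps_one (@fps_mul K n).
Proof.
move=> f; apply: fpsP => m; rewrite /fps_mul.
rewrite (@agreeM _ _ (mdeg m) _ 1 _ (trunc (mdeg m) f)) //.
  by rewrite mul1r mcoeff_trunc.
exact: agree_trunc_poly.
Qed.
Let mulD : left_distributive (@fps_mul K n) +%R.
Proof.
by move=> f g h; apply: fpsP => m; rewrite coeffsD /fps_mul trunc_add mulrDl mcoeffD.
Qed.
Let one_neq0 : fps_one != 0.
Proof.
apply/eqP => /(congr1 (fun f : fps K n => f 0%MM)) /eqP.
by rewrite /fps_one /fps_of_mpoly mcoeff1 eqxx oner_eq0.
Qed.

HB.instance Definition _ :=
  GRing.Zmodule_isComNzRing.Build (fps K n) mulA mulC mul1 mulD one_neq0.

Lemma agree_truncM d f g : agree d (trunc d (f * g)) (trunc d f * trunc d g).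
Proof. exact: agree_trunc_mul. Qed.

Lemma coeffsM f g d m : (mdeg m <= d)%N ->
  (f * g) m = (trunc d f * trunc d g)@_m.
Proof.
by move=> h; rewrite -(agree_trunc_mul f g h) mcoeff_trunc.
Qed.

Let of_mpoly_additive : additive (@fps_of_mpoly K n).
Proof. by move=> p q; apply: fpsP => m; rewrite /fps_of_mpoly mcoeffB. Qed.
HB.instance Definition _ :=
  GRing.isAdditive.Build {mpoly K[n]} (fps K n) (@fps_of_mpoly K n)
    of_mpoly_additive.

Let of_mpoly_multiplicative : multiplicative (@fps_of_mpoly K n).
Proof.
split=> // p q; apply: fpsP => m; rewrite (coeffsM _ _ (leqnn _)).
apply: agree_sym (leqnn _).
by apply: agreeM; apply: agree_trunc_poly.
Qed.
HB.instance Definition _ :=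
  GRing.isMultiplicative.Build {mpoly K[n]} (fps K n) (@fps_of_mpoly K n)
    of_mpoly_multiplicative.

Definition fX i : fps K n := fps_of_mpoly 'X_i.
Definition fC c : fps K n := fps_of_mpoly c%:MP.

End Ring.
Arguments fX {K n}.
Arguments fC {K n}.

Lemma coeffsM_sum (K : comNzRingType) n (f g : fps K n) a :
  (f * g) a = \sum_(k : 'X_{1..n < (mdeg a).+1, (mdeg a).+1} |
                    a == (k.1 + k.2)%MM) f k.1 * g k.2.
Proof.
rewrite (coeffsM f g (leqnn _)) mcoeffM; apply: eq_bigr => k _.
by rewrite !mcoeff_trunc // -ltnS bmdeg.
Qed.

(** * Substitution *)

Section Substitution.
Variable K : comNzRingType.

Lemma fmapP m n (F G : fmap K m n) : F =2 G -> F = G.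
Proof. by move=> h; apply: funext => i; apply: funext. Qed.

Lemma centered_comp l m n (F : fmap K l m) (G : fmap K m n) :
  centered F -> centered (fcomp F G).
Proof.
move=> hF i; rewrite /fcomp /fps_subst mdeg0 (_ : trunc 0 _ = 0) ?comp_mpoly0 ?mcoeff0 //.
rewrite /trunc big1 // => [[a /= ha]] _.
have -> : a = 0%MM by apply/eqP; rewrite -mdeg_eq0 -leqn0 -ltnS.
by rewrite hF scale0r.
Qed.

Section OneSubstitution.
Variables (m n : nat) (G : fmap K m n).
Hypothesis G0 : centered G.

Definition trunc_map d : m.-tuple {mpoly K[n]} := [tuple trunc d (G i) | i < m].

Lemma trunc_map0 d i : (tnth (trunc_map d) i)@_0%MM = 0.
Proof. by rewrite tnth_mktuple mcoeff_trunc ?mdeg0. Qed.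

Lemma agree_trunc_map d d' i : (d <= d')%N ->
  agree d (tnth (trunc_map d) i) (tnth (trunc_map d') i).
Proof. by move=> h; rewrite !tnth_mktuple; apply: agree_trunc. Qed.

Lemma substE d f a : (mdeg a <= d)%N ->
  fps_subst f G a = (trunc d f \mPo trunc_map d)@_a.
Proof.
move=> h; rewrite /fps_subst -/(trunc_map _).
apply: (agree_comp _ _ _) (leqnn _); first exact: agree_trunc.
  by move=> i; apply: agree_trunc_map.
exact: trunc_map0.
Qed.

Lemma agree_subst d f :
  agree d (trunc d (fps_subst f G)) (trunc d f \mPo trunc_map d).
Proof. by move=> a ha; rewrite (mcoeff_trunc _ ha) (substE _ ha). Qed.

Lemma substD f g : fps_subst (f + g) G = fps_subst f G + fps_subst g G.
Proof.
apply: fpsP => a; rewrite coeffsD /fps_subst trunc_add.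
by rewrite comp_mpolyD mcoeffD.
Qed.

Lemma subst0 : fps_subst 0 G = 0.
Proof. by apply: (@addrI _ (fps_subst 0 G)); rewrite -substD !addr0. Qed.

Lemma substN f : fps_subst (- f) G = - fps_subst f G.
Proof. by apply: (@addrI _ (fps_subst f G)); rewrite -substD !subrr subst0. Qed.

Lemma substB f g : fps_subst (f - g) G = fps_subst f G - fps_subst g G.
Proof. by rewrite substD substN. Qed.

Lemma substM f g : fps_subst (f * g) G = fps_subst f G * fps_subst g G.
Proof.
apply: fpsP => a; rewrite (coeffsM _ _ (leqnn _)) (substE _ (leqnn _)).
set d := mdeg a.
transitivity ((trunc d f * trunc d g) \mPo trunc_map d)@_a.
  apply: (agree_comp _ _ _) (leqnn _) => //; first exact: agree_truncM.
  exact: trunc_map0.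
rewrite rmorphM; apply: agree_sym (leqnn _).
by apply: agreeM; apply: agree_subst.
Qed.

Lemma subst_poly p :
  fps_subst (fps_of_mpoly p) G = \sum_(a <- msupp p) fC p@_a * \prod_i G i ^+ a i.
Proof.
apply: fpsP => a; rewrite (substE _ (leqnn _)); set d := mdeg a.
transitivity (trunc d (\sum_(a <- msupp p) fC p@_a * \prod_i G i ^+ a i))@_a;
  last by rewrite mcoeff_trunc.
have agS I (r : seq I) (F : I -> fps K n) : trunc d (\sum_(i <- r) F i)
    = \sum_(i <- r) trunc d (F i).
  elim: r => [|x r IH]; rewrite ?big_nil ?big_cons.
    by rewrite /trunc big1 // => ? _; rewrite scale0r.
  by rewrite trunc_add IH.
have agP I (r : seq I) (F : I -> fps K n) : agree d (trunc d (\prod_(i <- r) F i))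
    (\prod_(i <- r) trunc d (F i)).
  elim: r => [|x r IH]; rewrite ?big_nil ?big_cons.
    exact: agree_trunc_poly.
  by apply: agree_trans (@agree_truncM _ _ _ _ _) _; apply: agreeM.
have agX F k : agree d (trunc d (F ^+ k : fps K n)) (trunc d F ^+ k).
  elim: k => [|k IH]; rewrite ?exprS; first exact: agree_trunc_poly.
  by apply: agree_trans (@agree_truncM _ _ _ _ _) _; apply: agreeM.
rewrite agS; apply: (@agree_trans _ _ d (p \mPo trunc_map d) _ _ _ _ a (leqnn _)).
  by apply: agree_comp (@trunc_map0 d) => //; apply: agree_trunc_poly.
rewrite comp_mpolyEX; apply: agree_sum => b _; rewrite comp_mpolyX -mul_mpolyC.
apply: agree_sym; apply: agree_trans (@agree_truncM _ _ _ _ _) _; apply: agreeM.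
  exact: agree_trunc_poly.
apply: agree_trans (agP _ _ _) _; apply: agree_prod => i _.
by rewrite tnth_mktuple.
Qed.

Lemma substC c : fps_subst (fC c) G = fC c.
Proof.
rewrite subst_poly msuppC; case: eqP => [->|_].
  by rewrite big_nil /fC mpolyC0 raddf0.
by rewrite big_seq1 mcoeffC eqxx mulr1 big1 ?mulr1 // => i _; rewrite mnm0E.
Qed.

Lemma subst1 : fps_subst 1 G = 1.
Proof.
have -> : 1 = fC 1 :> fps K m by rewrite /fC mpolyC1 rmorph1.
by rewrite substC /fC mpolyC1 rmorph1.
Qed.

Lemma substX i : fps_subst (fX i) G = G i.
Proof.
rewrite subst_poly msuppX big_seq1 mcoeffX eqxx /fC mpolyC1 rmorph1 mul1r.
rewrite (bigD1 i) //= mnm1E eqxx big1 ?mulr1 // => j hj.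
by rewrite mnm1E eq_sym (negPf hj).
Qed.

Lemma substXn f k : fps_subst (f ^+ k) G = fps_subst f G ^+ k.
Proof. by elim: k => [|k IH]; rewrite ?subst1 // !exprS substM IH. Qed.

Lemma subst_sum I (r : seq I) (F : I -> fps K m) :
  fps_subst (\sum_(i <- r) F i) G = \sum_(i <- r) fps_subst (F i) G.
Proof.
by elim: r => [|x r IH]; rewrite ?big_nil ?subst0 // !big_cons substD IH.
Qed.

End OneSubstitution.

Lemma comp_mpolyA l m n (p : {mpoly K[l]}) (Q : l.-tuple {mpoly K[m]})
    (R : m.-tuple {mpoly K[n]}) :
  (p \mPo Q) \mPo R = p \mPo [tuple tnth Q i \mPo R | i < l].
Proof.
rewrite (comp_mpolyEX p Q) (comp_mpolyEX p) raddf_sum /=; apply: eq_bigr => a _.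
rewrite !comp_mpolyX comp_mpolyZ rmorph_prod; congr (_ *: _).
by apply: eq_bigr => i _; rewrite rmorphXn tnth_mktuple.
Qed.

(** Both sides are congruent to the composite of the truncations of [f], [G] and
    [H], in every degree. *)
Lemma substA l m n (f : fps K l) (G : fmap K l m) (H : fmap K m n) :
  centered G -> centered H ->
  fps_subst (fps_subst f G) H = fps_subst f (fcomp G H).
Proof.
move=> G0 H0; have GH0 := centered_comp H G0.
apply: fpsP => a; rewrite (substE H0 _ (leqnn _)) (substE GH0 _ (leqnn _)).
set d := mdeg a.
transitivity ((trunc d f \mPo trunc_map G d) \mPo trunc_map H d)@_a.
  apply: (agree_comp _ _ _) (leqnn _) => //; first exact: agree_subst.
  exact: trunc_map0.
rewrite comp_mpolyA; apply: agree_sym (leqnn _).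
apply: agree_comp => // i; rewrite !tnth_mktuple; first exact: agree_subst.
by rewrite -(substE H0) ?mdeg0 //; apply: GH0.
Qed.

Definition fid n : fmap K n n := fX.

Lemma centered_id n : centered (@fid n).
Proof. by move=> i; rewrite /fid /fX /fps_of_mpoly mcoeffX mnm1_eq0. Qed.

Lemma fps_comp_id n (f : fps K n) : fps_subst f (@fid n) = f.
Proof.
apply: fpsP => a; rewrite (substE (@centered_id n) _ (leqnn _)).
rewrite -[RHS](mcoeff_trunc (d := mdeg a)) // -[trunc _ _ in RHS]comp_mpoly_id.
apply: (agree_comp _ _ _) (leqnn _) => // i; rewrite !tnth_mktuple.
  exact: agree_trunc_poly.
by rewrite mcoeffX mnm1_eq0.
Qed.

Lemma fcompA l m n p (F : fmap K l m) (G : fmap K m n) (H : fmap K n p) :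
  centered G -> centered H -> fcomp (fcomp F G) H = fcomp F (fcomp G H).
Proof. by move=> G0 H0; apply: funext => i; apply: substA. Qed.

Lemma fcomp_id_r m n (F : fmap K m n) : fcomp F (@fid n) = F.
Proof. by apply: funext => i; apply: fps_comp_id. Qed.

Lemma fcomp_id_l m n (F : fmap K m n) : centered F -> fcomp (@fid m) F = F.
Proof. by move=> F0; apply: funext => i; apply: substX. Qed.

Lemma coeffsX n i (a : 'X_{1..n}) : (fX i : fps K n) a = (U_(i)%MM == a)%:R.
Proof. by rewrite /fX /fps_of_mpoly mcoeffX. Qed.

Lemma coeffsC n c (a : 'X_{1..n}) : (fC c : fps K n) a = c * (a == 0%MM)%:R.
Proof. by rewrite /fC /fps_of_mpoly mcoeffC. Qed.

Lemma coeffs0M n (f g : fps K n) : (f * g) 0%MM = f 0%MM * g 0%MM.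
Proof.
rewrite (coeffsM f g (d := 0)) ?mdeg0 // rmorphM /=.
by rewrite !mcoeff_trunc ?mdeg0.
Qed.

Lemma subst_coef0 m n (f : fps K m) (G : fmap K m n) : centered G ->
  fps_subst f G 0%MM = f 0%MM.
Proof.
move=> G0; pose F : fmap K 1 m := fun _ => f - fC (f 0%MM).
have F0 : centered F by move=> i; rewrite /F coeffsB coeffsC eqxx mulr1 subrr.
have h : fps_subst (f - fC (f 0%MM)) G 0%MM = 0 := centered_comp G F0 ord0.
rewrite -{1}(subrK (fC (f 0%MM)) f) substD // substC // coeffsD h add0r.
by rewrite coeffsC eqxx mulr1.
Qed.

End Substitution.

(** * Change of coefficients *)

Section CoefficientMap.
Variables (R S : comNzRingType) (theta : {rmorphism R -> S}).

Definition fps_map n (f : fps R n) : fps S n := fun a => theta (f a).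
Definition fmap_map m n (F : fmap R m n) : fmap S m n := fun i => fps_map (F i).

Lemma trunc_fps_map n d (f : fps R n) :
  trunc d (fps_map f) = map_mpoly theta (trunc d f).
Proof.
rewrite /trunc raddf_sum; apply: eq_bigr => a _.
by rewrite /= map_mpolyZ map_mpolyX.
Qed.

Lemma map_mpoly_comp m n (p : {mpoly R[m]}) (Q : m.-tuple {mpoly R[n]}) :
  map_mpoly theta (p \mPo Q) =
  map_mpoly theta p \mPo [tuple map_mpoly theta (tnth Q i) | i < m].
Proof.
rewrite (comp_mpolyEX p Q) [LHS]raddf_sum [in RHS](mpolyE p).
rewrite [map_mpoly _ _ in RHS]raddf_sum /= [RHS]raddf_sum.
apply: eq_bigr => a _ /=; rewrite !map_mpolyZ comp_mpolyZ map_mpolyX.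
rewrite !comp_mpolyX rmorph_prod; congr (_ *: _).
by apply: eq_bigr => i _; rewrite rmorphXn tnth_mktuple.
Qed.

Lemma fps_map_subst m n (f : fps R m) (G : fmap R m n) :
  fps_map (fps_subst f G) = fps_subst (fps_map f) (fmap_map G).
Proof.
apply: fpsP => a; rewrite /fps_map /fps_subst -mcoeff_map_mpoly map_mpoly_comp.
rewrite -!/(fps_map _) trunc_fps_map; congr ((_ \mPo _)@_a).
by apply: eq_from_tnth => i; rewrite !tnth_mktuple trunc_fps_map.
Qed.

Lemma fmap_map_comp l m n (F : fmap R l m) (G : fmap R m n) :
  fmap_map (fcomp F G) = fcomp (fmap_map F) (fmap_map G).
Proof. by apply: funext => i; apply: fps_map_subst. Qed.

Lemma fps_map_poly n (p : {mpoly R[n]}) :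
  fps_map (fps_of_mpoly p) = fps_of_mpoly (map_mpoly theta p).
Proof. by apply: fpsP => a; rewrite /fps_map /fps_of_mpoly mcoeff_map_mpoly. Qed.

Lemma fps_mapX n i : fps_map (fX i) = fX i :> fps S n.
Proof. by rewrite /fX fps_map_poly map_mpolyX. Qed.

Lemma fps_mapC n c : fps_map (fC c) = fC (theta c) :> fps S n.
Proof. by rewrite /fC fps_map_poly map_mpolyC. Qed.

Lemma fps_mapD n (f g : fps R n) : fps_map (f + g) = fps_map f + fps_map g.
Proof. by apply: fpsP => a; rewrite /fps_map coeffsD rmorphD. Qed.

Lemma fps_mapM n (f g : fps R n) : fps_map (f * g) = fps_map f * fps_map g.
Proof.
apply: fpsP => a; rewrite (coeffsM _ _ (leqnn _)) !trunc_fps_map -rmorphM.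
by rewrite mcoeff_map_mpoly /fps_map (coeffsM _ _ (leqnn _)).
Qed.

Lemma fps_map0 n : fps_map 0 = 0 :> fps S n.
Proof. by apply: fpsP => a; rewrite /fps_map rmorph0. Qed.

Lemma centered_map m n (F : fmap R m n) : centered F -> centered (fmap_map F).
Proof. by move=> F0 i; rewrite /fmap_map /fps_map F0 rmorph0. Qed.

Lemma jacobian_map m n (F : fmap R m n) :
  jacobian (fmap_map F) = map_mx theta (jacobian F).
Proof. by apply/matrixP => i j; rewrite !mxE. Qed.

End CoefficientMap.

(** * Order, linear parts and inverses *)

Opaque fps_subst trunc fps_mul.

Section Order.
Variable K : comNzRingType.

Definition feq n d (f g : fps K n) := vanish d (f - g).

Lemma vanish_leq n d d' (f : fps K n) : (d <= d')%N -> vanish d' f -> vanish d f.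
Proof. by move=> h hf a ha; rewrite hf // (leq_trans ha). Qed.

Lemma vanishD n d (f g : fps K n) : vanish d f -> vanish d g -> vanish d (f + g).
Proof. by move=> hf hg a ha; rewrite coeffsD hf ?hg ?addr0. Qed.

Lemma vanishN n d (f : fps K n) : vanish d f -> vanish d (- f).
Proof. by move=> hf a ha; rewrite coeffsN hf ?oppr0. Qed.

Lemma vanish_sum n d I (r : seq I) (P : pred I) (F : I -> fps K n) :
  (forall i, P i -> vanish d (F i)) -> vanish d (\sum_(i <- r | P i) F i).
Proof. by move=> h; elim/big_rec: _ => [|i x Pi]; [|apply: vanishD; apply: h]. Qed.

Lemma vanishM n a b (f g : fps K n) :
  vanish a f -> vanish b g -> vanish (a + b) (f * g).
Proof.
move=> hf hg c hc; rewrite (coeffsM f g (leqnn _)).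
exact: (order_geM (trunc_order_ge _ hf) (trunc_order_ge _ hg)) hc.
Qed.

Lemma vanish1 n (f : fps K n) : f 0%MM = 0 -> vanish 1 f.
Proof. by move=> h m; rewrite ltnS leqn0 mdeg_eq0 => /eqP ->. Qed.

Lemma vanishMl n d (f g : fps K n) : vanish d f -> vanish d (f * g).
Proof. by move=> h; rewrite -[d]addn0; apply: vanishM. Qed.

Lemma vanishMr n d (f g : fps K n) : vanish d g -> vanish d (f * g).
Proof. by rewrite mulrC; apply: vanishMl. Qed.

Lemma feqP n d (f g : fps K n) :
  feq d f g <-> forall a, (mdeg a < d)%N -> f a = g a.
Proof.
by split=> h a ha; [apply/subr0_eq/(h a ha)|rewrite coeffsB h // subrr].
Qed.

Lemma feq_refl n d (f : fps K n) : feq d f f. Proof. exact/feqP. Qed.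

Lemma feq_sym n d (f g : fps K n) : feq d f g -> feq d g f.
Proof. by move=> /feqP h; apply/feqP => a ha; rewrite h. Qed.

Lemma feq_trans n d (g f h : fps K n) : feq d f g -> feq d g h -> feq d f h.
Proof. by move=> /feqP fg /feqP gh; apply/feqP => a ha; rewrite fg // gh. Qed.

Lemma fC0 n : fC 0 = 0 :> fps K n.
Proof. by rewrite /fC mpolyC0 raddf0. Qed.

Lemma fC1 n : fC 1 = 1 :> fps K n.
Proof. by rewrite /fC mpolyC1 rmorph1. Qed.

Lemma coeffsCM n c (f : fps K n) a : (fC c * f) a = c * f a.
Proof.
rewrite (coeffsM _ f (leqnn _)) -[f a](mcoeff_trunc f (leqnn _)) -mcoeffCM.
by apply: (agreeM _ _) (leqnn _) => //; apply: agree_trunc_poly.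
Qed.

Lemma coeffsXM n i (f : fps K n) a : (fX i * f) (U_(i) + a)%MM = f a.
Proof.
rewrite (coeffsM _ f (leqnn _)).
set d := mdeg _; transitivity ('X_i * trunc d f)@_(U_(i) + a).
  by apply: (agreeM _ _) (leqnn _) => //; apply: agree_trunc_poly.
by rewrite mulrC mcoeffMX mcoeff_trunc // /d mdegD leq_addl.
Qed.

Lemma coeffsXM0 n i (f : fps K n) (a : 'X_{1..n}) : a i = 0%N -> (fX i * f) a = 0.
Proof.
move=> a0; rewrite (coeffsM _ f (leqnn _)).
transitivity ('X_i * trunc (mdeg a) f)@_a.
  by apply: (agreeM _ _) (leqnn _) => //; apply: agree_trunc_poly.
rewrite mcoeffM big1 // => k /eqP ak; rewrite mcoeffX.
case: eqP => [ik|]; last by rewrite mul0r.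
by have := congr1 (fun b : 'X_{1..n} => b i) ak; rewrite a0 mnmDE -ik mnm1E eqxx.
Qed.

Lemma fX_inj n i (f g : fps K n) : fX i * f = fX i * g -> f = g.
Proof. by move=> h; apply: fpsP => a; rewrite -(coeffsXM i) h coeffsXM. Qed.

(** The quotient of [f] by [X_i] restricted to the monomials in which [X_i] is
    the first variable to occur, so that the monomials of [f] are shared out
    among the variables without repetition. *)
Definition quotX n (i : 'I_n) (f : fps K n) : fps K n := fun a =>
  if [forall j : 'I_n, (j < i)%N ==> (a j == 0%N)] then f (U_(i) + a)%MM else 0.

Lemma quotX0 n i (f : fps K n) : quotX i f 0%MM = f U_(i)%MM.
Proof.
rewrite /quotX ifT ?addm0 //; apply/forallP => j; rewrite mnm0E eqxx.
exact: implybT.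
Qed.

Lemma quotX_vanish n d i (f : fps K n) : vanish d.+1 f -> vanish d (quotX i f).
Proof.
move=> h a ha; rewrite /quotX; case: ifP => // _; apply: h.
by rewrite mdegD mdeg1.
Qed.

Lemma divX n (f : fps K n) : f 0%MM = 0 -> f = \sum_i fX i * quotX i f.
Proof.
move=> f0; apply: fpsP => a.
rewrite coeffs_sum.
have [a0|/eqP an0] := eqVneq a 0%MM.
  by rewrite a0 f0 big1 // => i _; rewrite coeffsXM0 ?mnm0E.
have ex : exists k, [exists i : 'I_n, (a i != 0%N) && (i == k :> nat)].
  case: (boolP [exists i : 'I_n, a i != 0%N]) => [/existsP[i hi]|].
    by exists i; apply/existsP; exists i; rewrite hi eqxx.
  rewrite negb_exists => /forallP h; case: an0; apply/mnmP => i.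
  by rewrite mnm0E; apply/eqP; have := h i; rewrite negbK.
case: (ex_minnP ex) => k /existsP[i' /andP[ai' /eqP ik']] kmin.
rewrite (bigD1 i') //= big1 ?addr0 => [|j ji].
  have aE : a = (U_(i') + (a - U_(i')))%MM.
    apply/mnmP => l; rewrite mnmDE mnmBE mnm1E subnKC //.
    by case: eqP => // <-; rewrite lt0n.
  rewrite {2}aE coeffsXM /quotX ifT -?aE //; apply/forallP => j; apply/implyP => ji.
  rewrite mnmBE; case: (eqVneq (a j) 0%N) => [->//|aj]; exfalso.
  suff: (i' <= j)%N by rewrite leqNgt ji.
  by rewrite ik'; apply: kmin; apply/existsP; exists j; rewrite aj eqxx.
have [aj|aj] := eqVneq (a j) 0%N; first by rewrite coeffsXM0.
have aE : a = (U_(j) + (a - U_(j)))%MM.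
  apply/mnmP => l; rewrite mnmDE mnmBE mnm1E subnKC //.
  by case: eqP => // <-; rewrite lt0n.
rewrite aE coeffsXM /quotX ifF //; apply/negP => /forallP /(_ i').
have: (i' <= j)%N.
  by rewrite ik'; apply: kmin; apply/existsP; exists j; rewrite aj eqxx.
rewrite leq_eqVlt => /orP[/eqP /val_inj e|->]; first by rewrite e eqxx in ji.
by rewrite mnmBE mnm1E (negPf ji) subn0 (negPf ai').
Qed.

(** Hadamard's lemma, which turns statements on composites into inductions on
    the order. *)
Lemma subst_divX m n (f : fps K m) (G : fmap K m n) : centered G ->
  fps_subst f G = fC (f 0%MM) +
    \sum_i G i * fps_subst (quotX i (f - fC (f 0%MM))) G.
Proof.
move=> G0; rewrite -{1}(subrK (fC (f 0%MM)) f) substD // substC // addrC.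
congr (_ + _); rewrite {1}[f - _]divX; last first.
  by rewrite coeffsB coeffsC eqxx mulr1 subrr.
by rewrite subst_sum //; apply: eq_bigr => i _; rewrite substM // substX.
Qed.

Lemma subst_vanish m n d (f : fps K m) (G : fmap K m n) :
  centered G -> vanish d f -> vanish d (fps_subst f G).
Proof.
move=> G0; elim: d f => // d IH f hf; rewrite subst_divX // hf ?mdeg0 //.
rewrite !fC0 add0r subr0; apply: vanish_sum => i _; rewrite -add1n.
by apply: vanishM; [exact: vanish1 (G0 i)|apply/IH/quotX_vanish].
Qed.

Lemma feq_subst m n d (f : fps K m) (G G' : fmap K m n) :
  centered G -> centered G' -> (forall i, feq d (G i) (G' i)) ->
  feq d (fps_subst f G) (fps_subst f G').
Proof.
move=> G0 G0'; elim: d f => // d IH f hG.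
rewrite (subst_divX f G0) (subst_divX f G0') /feq opprD addrACA subrr add0r.
rewrite -sumrB; apply: vanish_sum => i _.
set g := quotX _ _.
have -> : G i * fps_subst g G - G' i * fps_subst g G' =
    G i * (fps_subst g G - fps_subst g G') + (G i - G' i) * fps_subst g G'.
  by rewrite mulrBr mulrBl addrA subrK.
apply: vanishD; last by apply: vanishMl; apply: hG.
rewrite -add1n; apply: vanishM; first exact: vanish1 (G0 i).
by apply: IH => j; apply: vanish_leq (hG j).
Qed.

Lemma feq_substl m n d (f f' : fps K m) (G : fmap K m n) :
  centered G -> feq d f f' -> feq d (fps_subst f G) (fps_subst f' G).
Proof. by move=> G0 h; rewrite /feq -substB //; apply: subst_vanish. Qed.

(** The gain of one order makes the inversion of formal maps a contraction. *)
Lemma feq_subst_gain m n d (h : fps K m) (G G' : fmap K m n) :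
  centered G -> centered G' -> vanish 2 h -> (forall i, feq d (G i) (G' i)) ->
  feq d.+1 (fps_subst h G) (fps_subst h G').
Proof.
move=> G0 G0' h2 hG.
have h0 : h 0%MM = 0 by apply: h2; rewrite mdeg0.
rewrite (subst_divX h G0) (subst_divX h G0') /feq opprD addrACA subrr add0r.
rewrite -sumrB; apply: vanish_sum => i _.
set g := quotX _ _; have g1 : vanish 1 g.
  by apply: quotX_vanish; rewrite h0 fC0 subr0.
have -> : G i * fps_subst g G - G' i * fps_subst g G' =
    G i * (fps_subst g G - fps_subst g G') + (G i - G' i) * fps_subst g G'.
  by rewrite mulrBr mulrBl addrA subrK.
apply: vanishD; last first.
  by rewrite -addn1; apply: vanishM (hG i) (subst_vanish G0' g1).
rewrite -add1n; apply: vanishM; first exact: vanish1 (G0 i).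
exact: feq_subst.
Qed.

(** The iterates of [N] stabilize in each degree, hence have a limit. *)
Lemma contraction_fixpoint m n (N : fmap K m n -> fmap K m n) :
  (forall F F' d, (forall i, feq d (F i) (F' i)) ->
     forall i, feq d.+1 (N F i) (N F' i)) ->
  exists F, N F = F.
Proof.
move=> hN; pose S k : fmap K m n := iter k N (fun _ => 0).
have step k i : feq k (S k i) (S k.+1 i).
  by elim: k i => // k IH i; apply: hN.
have le k l i : (k <= l)%N -> feq k (S k i) (S l i).
  move=> /subnK <-; elim: (l - k)%N => [|e IH]; first exact: feq_refl.
  apply: feq_trans IH _; rewrite addSn; apply: vanish_leq (step _ _).
  exact: leq_addl.
pose F : fmap K m n := fun i a => S (mdeg a).+1 i a.
have hF k i : feq k (F i) (S k i).
  by apply/feqP => a ha; apply: (proj1 (feqP _ _ _) (le _ _ i ha)).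
exists F; apply: fmapP => i a.
exact: (proj1 (feqP _ _ _) (hN _ _ _ (hF (mdeg a)) i)).
Qed.

Lemma coeffsUM n i (f g : fps K n) :
  (f * g) U_(i)%MM = f U_(i)%MM * g 0%MM + f 0%MM * g U_(i)%MM.
Proof.
have dec (h : fps K n) : exists2 c, vanish 1 c & h = c + fC (h 0%MM).
  exists (h - fC (h 0%MM)); last by rewrite subrK.
  by apply: vanish1; rewrite coeffsB coeffsC eqxx mulr1 subrr.
have [f' f1 fE] := dec f; have [g' g1 gE] := dec g.
move: (f 0%MM) (g 0%MM) fE gE => a b -> ->.
rewrite mulrDl !mulrDr [f' * fC _]mulrC !coeffsD !coeffsCM.
have -> : (f' * g') U_(i)%MM = 0 by apply: (vanishM f1 g1); rewrite mdeg1.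
by rewrite !coeffsC mnm1_eq0 !mulr0 add0r !addr0 [f' _ * b]mulrC.
Qed.

Lemma jacobian_comp l m n (F : fmap K l m) (G : fmap K m n) : centered G ->
  jacobian (fcomp F G) = jacobian F *m jacobian G.
Proof.
move=> G0; apply/matrixP => i j; rewrite !mxE /fcomp subst_divX // coeffsD.
rewrite coeffsC mnm1_eq0 mulr0 add0r coeffs_sum.
apply: eq_bigr => k _; rewrite !mxE coeffsUM G0 mul0r addr0 mulrC.
by rewrite subst_coef0 // quotX0 coeffsB coeffsC mnm1_eq0 mulr0 subr0.
Qed.

Lemma jacobian_id n : jacobian (@fid K n) = 1%:M.
Proof.
apply/matrixP => i j; rewrite !mxE /fid coeffsX.
have [->|ij] := eqVneq i j; first by rewrite eqxx.
rewrite (_ : (_ == _) = false) //; apply/negP => /eqP/mnmP/(_ j).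
by rewrite !mnm1E eqxx (negPf ij).
Qed.

Definition linmap m n (A : 'M[K]_(m, n)) : fmap K m n :=
  fun i => \sum_j fC (A i j) * fX j.

Lemma centered_linmap m n (A : 'M[K]_(m, n)) : centered (linmap A).
Proof.
move=> i; rewrite /linmap; elim/big_ind: _ => // [f g hf hg|j _].
  by rewrite coeffsD hf hg addr0.
by rewrite coeffs0M coeffsX mnm1_eq0 mulr0.
Qed.

Lemma linmapE l m n (A : 'M[K]_(l, m)) (G : fmap K m n) : centered G ->
  fcomp (linmap A) G = fun i => \sum_j fC (A i j) * G j.
Proof.
move=> G0; apply: funext => i; rewrite /fcomp /linmap subst_sum //.
by apply: eq_bigr => j _; rewrite substM // substX // substC.
Qed.

Lemma linmapM l m n (A : 'M[K]_(l, m)) (B : 'M[K]_(m, n)) :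
  fcomp (linmap A) (linmap B) = linmap (A *m B).
Proof.
rewrite linmapE; last exact: centered_linmap.
apply: funext => i; rewrite /linmap.
under eq_bigr do rewrite mulr_sumr.
rewrite exchange_big; apply: eq_bigr => j _; rewrite mxE.
rewrite /fC rmorph_sum raddf_sum mulr_suml; apply: eq_bigr => k _.
by rewrite mulrA -rmorphM /= -mpolyCM.
Qed.

Lemma linmap1 n : linmap 1%:M = @fid K n.
Proof.
apply: funext => i; rewrite /linmap (bigD1 i) //= mxE eqxx mulr1n.
rewrite {1}/fC mpolyC1 rmorph1 mul1r big1 ?addr0 // => j ji.
by rewrite mxE eq_sym (negPf ji) mulr0n /fC mpolyC0 raddf0 mul0r.
Qed.

Lemma jacobian_linmap m n (A : 'M[K]_(m, n)) : jacobian (linmap A) = A.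
Proof.
apply/matrixP => i j; rewrite mxE /linmap coeffs_sum.
rewrite (bigD1 j) //= big1 => [|k kj]; rewrite coeffsCM coeffsX; last first.
  rewrite (_ : (_ == _) = false) ?mulr0 //; apply/negP => /eqP/mnmP/(_ j).
  by rewrite !mnm1E eqxx (negPf kj).
by rewrite eqxx mulr1 addr0.
Qed.

End Order.

Section Inverse.
Variable K : fieldType.

(** The inverse [g] of [f] solves [f(0) g = 1 - (f - f(0)) g]. *)
Lemma fps_unit n (f : fps K n) : f 0%MM != 0 -> exists g, f * g = 1.
Proof.
move=> f0; pose c := (f 0%MM)^-1.
pose N (F : fmap K 1 n) : fmap K 1 n :=
  fun i => fC c * (1 - (f - fC (f 0%MM)) * F i).
have [|F FE] := contraction_fixpoint (N := N).
  move=> F F' d h i; rewrite /N /feq -mulrBr; apply: vanishMr.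
  have -> (u : fps K n) : (1 - u * F i) - (1 - u * F' i) = u * - (F i - F' i).
    by rewrite opprD addrACA subrr add0r opprK mulrN mulrBr opprB addrC.
  rewrite -add1n; apply: vanishM; last exact/vanishN/h.
  by apply: vanish1; rewrite ?/c coeffsB coeffsC eqxx mulr1 subrr.
exists (F ord0); have := congr1 (fun G => G ord0) FE; rewrite /N.
set u := F ord0 => h.
have cc : fC (f 0%MM) * fC c = 1 :> fps K n.
  by rewrite -rmorphM -mpolyCM mulfV // mpolyC1 rmorph1.
have h2 : fC (f 0%MM) * u = 1 - (f - fC (f 0%MM)) * u.
  by rewrite -{1}h mulrA cc mul1r.
by rewrite -[in LHS](subrK (fC (f 0%MM)) f) mulrDl h2 addrC subrK.
Qed.

Lemma formal_diffeo_comp n (F G : fmap K n n) :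
  formal_diffeo F -> formal_diffeo G -> formal_diffeo (fcomp F G).
Proof.
move=> [F0 JF] [G0 JG]; split; first exact: centered_comp.
by rewrite jacobian_comp // unitmx_mul JF.
Qed.

Lemma diffeo_of_inverse n (F G : fmap K n n) : centered F -> centered G ->
  fcomp F G = @fid K n -> formal_diffeo F /\ formal_diffeo G.
Proof.
move=> F0 G0 /(congr1 (@jacobian K n n)); rewrite jacobian_comp // jacobian_id.
by move=> /mulmx1_unit[JF JG].
Qed.

Lemma diffeo_linmap n (A : 'M[K]_n) : A \in unitmx -> formal_diffeo (linmap A).
Proof.
by move=> hA; split; [exact: centered_linmap|rewrite jacobian_linmap].
Qed.

(** After composing with the inverse of the linear part, [F] becomes [id + h]
    with [h] of order two, and the inverse [G] solves [G = id - h o G]. *)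
Lemma formal_diffeo_right_inverse n (F : fmap K n n) : formal_diffeo F ->
  exists2 G, formal_diffeo G & fcomp F G = @fid K n.
Proof.
move=> [F0 JF]; pose A := jacobian F; pose L := linmap (invmx A).
pose h : fmap K n n := fun i => fcomp L F i - fX i.
have L0 : centered L by apply: centered_linmap.
have h2 i : vanish 2 (h i).
  have LF0 := centered_comp F L0.
  move=> a; rewrite ltnS leq_eqVlt ltnS leqn0 => /orP[|]; last first.
    by rewrite mdeg_eq0 => /eqP ->; rewrite /h coeffsB LF0 coeffsX mnm1_eq0 subr0.
  move=> /mdeg1P[j /eqP ->]; rewrite /h coeffsB.
  have -> : fcomp L F i U_(j)%MM = jacobian (fcomp L F) i j by rewrite mxE.
  have -> : (fX i : fps K n) U_(j)%MM = jacobian (@fid K n) i j by rewrite mxE.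
  by rewrite jacobian_comp // jacobian_linmap mulVmx // jacobian_id subrr.
(* Recentring makes the operator a contraction on all maps [G]. *)
pose cen (G : fmap K n n) : fmap K n n := fun i => G i - fC (G i 0%MM).
have cen0 G : centered (cen G).
  by move=> i; rewrite /cen coeffsB coeffsC eqxx mulr1 subrr.
pose N (G : fmap K n n) : fmap K n n := fun i => fX i - fps_subst (h i) (cen G).
have N0 G : centered (N G).
  move=> i; rewrite /N coeffsB coeffsX mnm1_eq0 sub0r.
  by rewrite (subst_vanish (d := 1) (cen0 G)) ?mdeg0 ?oppr0 //; apply: vanish_leq (h2 i).
have [|G GE] := contraction_fixpoint (N := N).
  move=> G G' d hG i; apply: feq_sym; rewrite /N /feq opprD addrACA subrr add0r opprK addrC.
  apply: feq_subst_gain => // j; case: d hG => // d hG.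
  apply/feqP => a ha; rewrite /cen !coeffsB !coeffsC.
  by rewrite !(proj1 (feqP _ _ _) (hG j)) ?mdeg0.
have G0 : centered G by rewrite -GE.
have LFG : fcomp (fcomp L F) G = @fid K n.
  apply: funext => i.
  have -> : fcomp L F = fun i => h i + fX i.
    by apply: funext => k; rewrite /h subrK.
  have cG : cen G = G.
    apply: funext => k; rewrite /cen G0 /fC mpolyC0 raddf0 subr0.
    by [].
  have Gi : G i = fX i - fps_subst (h i) G by rewrite -{1}GE /N cG.
  by rewrite /fcomp substD // substX // [X in _ + X]Gi addrC subrK.
(* [G] inverts [L o F] only, whence the inverse [G o L] of [F]. *)
have GL : fcomp F (fcomp G L) = @fid K n.
  have AL : fcomp (linmap A) L = @fid K n by rewrite linmapM mulmxV // linmap1.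
  have FE : F = fcomp (linmap A) (fcomp L F).
    by rewrite -(fcompA _ L0 F0) AL fcomp_id_l.
  have FG : fcomp F G = linmap A.
    rewrite FE (fcompA _ (centered_comp F L0) G0) LFG.
    exact: fcomp_id_r.
  by rewrite -(fcompA _ G0 L0) FG; exact: AL.
exists (fcomp G L) => //.
by have [] := diffeo_of_inverse F0 (centered_comp L G0) GL.
Qed.

Lemma formal_diffeo_inverse n (F : fmap K n n) : formal_diffeo F ->
  exists G, [/\ formal_diffeo G, fcomp F G = @fid K n & fcomp G F = @fid K n].
Proof.
move=> dF; have [G dG FG] := formal_diffeo_right_inverse dF.
have [H dH GH] := formal_diffeo_right_inverse dG.
have FH : F = H.
  by rewrite -(fcomp_id_l dH.1) -FG (fcompA _ dG.1 dH.1) GH fcomp_id_r.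
by exists G; split; [exact: dG|exact: FG|rewrite FH; exact: GH].
Qed.

End Inverse.

(** * Isomorphisms of trees of infinitely near points *)

Lemma sum_ord2 (V : nmodType) (F : 'I_2 -> V) : \sum_i F i = F 0 + F 1.
Proof. by rewrite big_ord_recl big_ord1; congr (_ + F _); apply: val_inj. Qed.

Section TreeIso.
Variable K : fieldType.

(** Passing through a point goes forwards and normal crossings go backwards,
    since both are obtained by transporting germs from [C] to [C']. *)
Definition carries r r' (C : 'I_r -> fmap K 2 1) (C' : 'I_r' -> fmap K 2 1)
    (b : 'I_r -> 'I_r') (k : inf_near K -> inf_near K) : Prop :=
  (forall A p, passes C A p -> passes C' (map_divisor b k A) (k p)) /\
  (forall p, normal_crossings C' (k p) -> normal_crossings C p).

(** The bijection is required on all infinitely near points and not only on the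
    centres: the notions of centre, of final point and of incidence are then
    transported without any knowledge of the desingularization. *)
Definition tree_iso r r' (C : 'I_r -> fmap K 2 1) (C' : 'I_r' -> fmap K 2 1)
    (b : 'I_r -> 'I_r') : Prop :=
  exists b' k k',
    [/\ cancel b b' /\ cancel b' b, cancel k k' /\ cancel k' k,
        {homo k : p q / prefix p q} /\ {homo k' : p q / prefix p q},
        carries C C' b k & carries C' C b' k'].

Lemma map_divisor_comp r1 r2 r3 (b : 'I_r1 -> 'I_r2) (c : 'I_r2 -> 'I_r3) k l
    (A : divisor K r1) :
  map_divisor c l (map_divisor b k A) = map_divisor (c \o b) (l \o k) A.
Proof. by case: A. Qed.

Lemma map_divisorK r r' (b : 'I_r -> 'I_r') b' k k' :
  cancel b b' -> cancel k k' ->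
  cancel (@map_divisor K r r' b k) (map_divisor b' k').
Proof. by move=> hb hk [i|q] /=; rewrite ?hb ?hk. Qed.

Lemma carries_trans r1 r2 r3 (C1 : 'I_r1 -> fmap K 2 1)
    (C2 : 'I_r2 -> fmap K 2 1) (C3 : 'I_r3 -> fmap K 2 1) b c k l :
  carries C1 C2 b k -> carries C2 C3 c l -> carries C1 C3 (c \o b) (l \o k).
Proof.
move=> [p1 n1] [p2 n2]; split=> [A p /p1/p2|p /n2/n1//].
by rewrite map_divisor_comp.
Qed.

Lemma tree_iso_trans r1 r2 r3 (C1 : 'I_r1 -> fmap K 2 1)
    (C2 : 'I_r2 -> fmap K 2 1) (C3 : 'I_r3 -> fmap K 2 1) b c :
  tree_iso C1 C2 b -> tree_iso C2 C3 c -> tree_iso C1 C3 (c \o b).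
Proof.
move=> [b' [k [k' [[h1 h1'] [h2 h2'] [h3 h3'] h4 h4']]]].
move=> [c' [l [l' [[g1 g1'] [g2 g2'] [g3 g3'] g4 g4']]]].
exists (b' \o c'), (l \o k), (k' \o l'); split.
- by split; apply: can_comp.
- by split; apply: can_comp.
- by split=> p q h /=; [apply/g3/h3|apply/h3'/g3'].
- exact: carries_trans h4 g4.
- exact: carries_trans g4' h4'.
Qed.

Lemma tree_iso_sym_id r (C C' : 'I_r -> fmap K 2 1) :
  tree_iso C C' id -> tree_iso C' C id.
Proof.
move=> [b [k [k' [[h1 h1'] [h2 h2'] [h3 h3'] h4 h4']]]].
have e : b = id by apply: funext => i; exact: h1.
by exists id, k', k; rewrite e in h4'.
Qed.

Lemma tree_iso_combinatorial r r' (C : 'I_r -> fmap K 2 1)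
    (C' : 'I_r' -> fmap K 2 1) b :
  tree_iso C C' b -> combinatorially_isomorphic C C'.
Proof.
move=> [b' [k [k' [[bK bK'] [kK kK'] [kp kp'] [pa nc] [pa' nc']]]]].
have prefE p q : prefix (k p) (k q) = prefix p q.
  by apply/idP/idP => [/kp'|/kp //]; rewrite !kK.
have ncE p : normal_crossings C' (k p) <-> normal_crossings C p.
  by split=> [/nc //|h]; apply: nc'; rewrite kK.
have cE p : centre C' (k p) <-> centre C p.
  split=> h q hq.
    by rewrite -ncE; apply: h; rewrite prefE.
  by rewrite -[q]kK' ncE; apply: h; rewrite -prefE kK'.
have paE A p : passes C A p <-> passes C' (map_divisor b k A) (k p).
  by split=> [/pa //|/pa']; rewrite kK map_divisorK.
have fE p : final_point C' (k p) <-> final_point C p.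
  rewrite /final_point; move: (centre C) (centre C') cE => P Q PQ.
  split=> -[h1 h2]; split; rewrite ?PQ // -?PQ // => q hq qp.
    by rewrite -PQ; apply: h2; rewrite ?prefE // (can_eq kK).
  rewrite -[q]kK' PQ; apply: h2; first by rewrite -prefE kK'.
  by apply: contra_neq qp => <-; rewrite kK'.
exists b, k; split.
- exact: Bijective bK bK'.
- split=> [p /cE //|p q _ _ /(can_inj kK) //|p' hp'].
  by exists (k' p'); rewrite ?kK' // -cE kK'.
- by move=> p q _ _; exact: prefE.
- by move=> A p _ _; exact: paE.
- move=> A B _ _; split=> -[p [h1 h2 h3]].
    by exists (k p); split; [exact/fE|exact/paE|exact/paE].
  exists (k' p); split; first by apply/fE; rewrite kK'.
    by apply/paE; rewrite kK'.
  by apply/paE; rewrite kK'.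
Qed.

Lemma det_mx2 (A : 'M[K]_2) : \det A = A 0 0 * A 1 1 - A 0 1 * A 1 0.
Proof.
have e0 : lift 0 0 = 1 :> 'I_2 by apply: val_inj.
have e1 : lift 1 0 = 0 :> 'I_2 by apply: val_inj.
rewrite (expand_det_row _ 0) big_ord_recl big_ord1 /cofactor !det_mx11 !mxE.
by rewrite !e0 !e1 expr0 expr1 mul1r mulN1r mulrN.
Qed.

Lemma det_row_mx2 (a b : 'cV[K]_2) :
  \det (row_mx a b : 'M_2) = a 0 0 * b 1 0 - b 0 0 * a 1 0.
Proof.
rewrite det_mx2.
have c0 i : (row_mx a b : 'M_2) i 0 = a i 0.
  by rewrite -(row_mxEl a b); congr (row_mx a b _ _); apply: val_inj.
have c1 i : (row_mx a b : 'M_2) i 1 = b i 0.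
  by rewrite -(row_mxEr a b); congr (row_mx a b _ _); apply: val_inj.
by rewrite !c0 !c1.
Qed.

Lemma det_row_mx2_mul (M : 'M[K]_2) (x y : 'cV[K]_2) c c' :
  \det (row_mx (c *: (M *m x)) (c' *: (M *m y)) : 'M_2) =
  c * c' * (\det M * \det (row_mx x y : 'M_2)).
Proof.
by rewrite 2!det_row_mx2 det_mx2 !mxE !sum_ord2; ring.
Qed.

(** [R p] relates the linear parts of a germ at [p] and of its transport; it has
    to reflect smoothness and transversality. *)
Lemma carries_of_germs r r' (C : 'I_r -> fmap K 2 1) (C' : 'I_r' -> fmap K 2 1)
    (b : 'I_r -> 'I_r') (k : inf_near K -> inf_near K)
    (R : inf_near K -> 'cV[K]_2 -> 'cV[K]_2 -> Prop) :
  injective b -> injective k ->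
  (forall p x x', R p x x' -> x' != 0 -> x != 0) ->
  (forall p x x' y y', R p x x' -> R p y y' ->
     \det (row_mx x' y' : 'M_2) != 0 -> \det (row_mx x y : 'M_2) != 0) ->
  (forall A p t, germ_at C A p t -> exists t',
     germ_at C' (map_divisor b k A) (k p) t' /\
     R p (jacobian t) (jacobian t')) ->
  carries C C' b k.
Proof.
move=> ib ik R0 Rdet hg.
have inj : injective (@map_divisor K r r' b k).
  by move=> [i|q] [j|q'] //= [] h; congr (_ _); [apply: ib|apply: ik].
have pa A p : passes C A p -> passes C' (map_divisor b k A) (k p).
  by move=> [t /hg[t' [gt _]]]; exists t'.
split=> // p [sm tr two]; split.
- by move=> A t /hg[t' [/sm h /R0]]; apply.
- move=> A B t t' AB /hg[u [gu Ru]] /hg[u' [gu' Ru']].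
  apply: Rdet Ru Ru' _; apply: tr gu gu'; by move=> /inj.
- move=> A B D /pa hA /pa hB /pa hD.
  by case: (two _ _ _ hA hB hD) => /inj e; [apply: Or31|apply: Or32|apply: Or33].
Qed.

End TreeIso.

(** * Lifting diffeomorphisms to blow-ups *)

Section BlowUp.
Variable K : fieldType.
Implicit Types d : direction K.

Lemma fmap2P n (F G : fmap K 2 n) : F 0 = G 0 -> F 1 = G 1 -> F = G.
Proof.
move=> h0 h1; apply: funext => -[[|[|//]] h].
  by rewrite (_ : Ordinal h = 0) //; apply: val_inj.
by rewrite (_ : Ordinal h = 1) //; apply: val_inj.
Qed.

Definition exc_coord d : 'I_2 := if d is Some _ then 0 else 1.
Definition other_coord d : 'I_2 := if d is Some _ then 1 else 0.

Lemma chart0 d : chart d 0 = if d is Some _ then fX 0 else fX 0 * fX 1.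
Proof. by case: d => [c|] //=; rewrite /chart rmorphM. Qed.

Lemma chart1 d :
  chart d 1 = if d is Some c then fX 0 * (fC c + fX 1) else fX 1.
Proof. by case: d => [c|] //=; rewrite /chart rmorphM rmorphD. Qed.

Lemma centered_chart d : centered (chart d).
Proof.
move=> i; case: d => [c|]; rewrite /chart /fps_of_mpoly; case: ifP => _;
  by rewrite ?rmorphM /= mcoeffX mnm1_eq0 ?mul0r ?mulr0.
Qed.

Lemma exc_lineE d :
  exc_line d = fun i => if i == exc_coord d then 0 else fX 0.
Proof.
apply: fmap2P; case: d => [c|] //=; rewrite /exc_line //= raddf0 //.
Qed.

Lemma centered_exc_line d : centered (exc_line d).
Proof.
by rewrite exc_lineE => i; case: ifP => // _; rewrite coeffsX mnm1_eq0.
Qed.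

(** The value of [g] at the origin is that of the linear part of [f] on the
    direction [d]; for the two components of a diffeomorphism these values give
    the image of [d]. *)
Lemma subst_chart (f : fps K 2) d : f 0%MM = 0 ->
  exists2 g : fps K 2, fps_subst f (chart d) = fX (exc_coord d) * g &
    g 0%MM = if d is Some c then f U_(0%R)%MM + c * f U_(1%R)%MM else f U_(1%R)%MM.
Proof.
move=> f0; have c0 := centered_chart d.
have e : fps_subst f (chart d) = chart d 0 * fps_subst (quotX 0 f) (chart d)
                               + chart d 1 * fps_subst (quotX 1 f) (chart d).
  by rewrite {1}[f]divX // sum_ord2 substD // !substM // !substX.
set g0 := fps_subst (quotX 0 f) _ in e; set g1 := fps_subst (quotX 1 f) _ in e.
have v0 : g0 0%MM = f U_(0%R)%MM by rewrite /g0 subst_coef0 // quotX0.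
have v1 : g1 0%MM = f U_(1%R)%MM by rewrite /g1 subst_coef0 // quotX0.
move: e; rewrite chart0 chart1; case: d c0 @g0 @g1 v0 v1 => [c|] c0 g0 g1 v0 v1 e /=.
  exists (g0 + (fC c + fX 1) * g1); first by rewrite e [RHS]mulrDr mulrA.
  rewrite coeffsD coeffs0M coeffsD v0 v1 coeffsC eqxx mulr1 coeffsX mnm1_eq0.
  by rewrite addr0.
exists (fX 0 * g0 + g1); first by rewrite e [RHS]mulrDr [fX 0 * fX 1]mulrC -mulrA.
by rewrite coeffsD coeffs0M coeffsX mnm1_eq0 mul0r add0r v1.
Qed.

(** [G], centred at the point [d'] of the exceptional line, is the lift of [F]
    at the point [d], and it preserves the exceptional line. *)
Definition lifts (F : fmap K 2 2) d d' (G : fmap K 2 2) : Prop :=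
  [/\ centered G, fcomp F (chart d) = fcomp (chart d') G
    & fps_subst (G (exc_coord d')) (exc_line d) = 0].

(** Both components of [F o chart d] are divisible by the equation of the
    exceptional line, and the quotients [A0], [A1] do not both vanish at the
    origin because the linear part of [F] is invertible: their values are the
    homogeneous coordinates of the image direction. *)
Lemma lift_exists F d : formal_diffeo F -> exists d' G, lifts F d d' G.
Proof.
move=> [F0 JF]; have [A0 e0 v0] := subst_chart d (F0 0).
have [A1 e1 v1] := subst_chart d (F0 1).
have x0 g : fps_subst (fX (exc_coord d) * g) (exc_line d) = 0.
  have ce := centered_exc_line d.
  by rewrite substM // substX // exc_lineE eqxx mul0r.
have [a0|a0] := eqVneq (A0 0%MM) 0.
  have a1 : A1 0%MM != 0.
    apply/negP => /eqP a1.
    pose v : 'cV[K]_2 := \col_i if i == exc_coord d then 1 else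
      if d is Some c then c else 0.
    have Jv : jacobian F *m v = 0.
      apply/matrixP => i j; rewrite !mxE sum_ord2 !mxE.
      have i01 : i = 0 \/ i = 1.
        by case: i => -[|[|//]] h; [left|right]; apply: val_inj.
      rewrite a0 in v0; rewrite a1 in v1.
      case: i01 => ->; case: d v v0 v1 {e0 e1 x0} => [c|] v v0 v1 /=.
      - by rewrite mulr1 [_ * c]mulrC -v0.
      - by rewrite mulr0 add0r mulr1 -v0.
      - by rewrite mulr1 [_ * c]mulrC -v1.
      - by rewrite mulr0 add0r mulr1 -v1.
    have /matrixP/(_ (exc_coord d) 0) : v = 0.
      by rewrite -[v]mul1mx -(mulVmx JF) -mulmxA Jv mulmx0.
    by rewrite !mxE eqxx => /eqP; rewrite oner_eq0.
  have [g hg] := fps_unit a1.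
  exists None, (fun i => if i == 0 then A0 * g else fX (exc_coord d) * A1).
  have G0 : centered (fun i : 'I_2 => if i == 0 then A0 * g else fX (exc_coord d) * A1).
    move=> i /=; case: ifP => _; rewrite coeffs0M ?a0 ?mul0r //.
    by rewrite coeffsX mnm1_eq0 mul0r.
  split; [exact: G0| |by rewrite /= x0].
  apply: fmap2P; rewrite /fcomp.
    rewrite chart0 substM // !substX //= e0 mulrCA -mulrA.
    by rewrite [g * _]mulrC hg mulr1.
  by rewrite chart1 substX.
have [g hg] := fps_unit a0; pose c := A1 0%MM / A0 0%MM.
exists (Some c), (fun i => if i == 0 then fX (exc_coord d) * A0 else A1 * g - fC c).
have g0 : g 0%MM = (A0 0%MM)^-1.
  apply: (mulfI a0); rewrite -coeffs0M hg mulfV //.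
  by rewrite /GRing.one /= /fps_one /fps_of_mpoly mcoeff1 eqxx.
have G0 : centered (fun i : 'I_2 => if i == 0 then fX (exc_coord d) * A0 else A1 * g - fC c).
  move=> i /=; case: ifP => _.
    by rewrite coeffs0M coeffsX mnm1_eq0 mul0r.
  by rewrite coeffsB coeffs0M g0 coeffsC eqxx mulr1 subrr.
split; [exact: G0| |by rewrite /= x0].
apply: fmap2P; rewrite /fcomp.
  by rewrite chart0 substX.
rewrite chart1 substM // substD // !substX // substC //= e1 addrC subrK.
by rewrite mulrACA hg mulr1.
Qed.

(** The blow-down map is injective off the exceptional line, so that lifts are
    unique; directions included, because lifts are centred. *)
Lemma chart_cancel d d' (H : fmap K 2 2) : centered H ->
  fcomp (chart d') H = chart d -> d' = d /\ H = @fid K 2.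
Proof.
move=> H0 h; have := congr1 (fun G => G 0) h; have := congr1 (fun G => G 1) h.
rewrite /fcomp !chart0 !chart1 {h}.
have one0 : (1 : fps K 2) 0%MM = 1.
  by rewrite /GRing.one /= /fps_one /fps_of_mpoly mcoeff1 eqxx.
case: d' d => [c'|] [c|]; rewrite ?(substM, substD, substX, substC) //.
- move=> h1 h0; rewrite h0 in h1; have h2 := fX_inj h1.
  have cc : c' = c.
    have := congr1 (fun f : fps K 2 => f 0%MM) h2; rewrite !coeffsD H0 !coeffsC.
    by rewrite eqxx coeffsX mnm1_eq0 !addr0 !mulr1.
  rewrite cc in h2 *; split=> //; apply: fmap2P => //.
  exact: addrI h2.
- move=> h1 h0; exfalso; rewrite h0 [fX 0 * _]mulrC -mulrA -[RHS]mulr1 in h1.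
  have := congr1 (fun f : fps K 2 => f 0%MM) (fX_inj h1).
  rewrite coeffs0M coeffsX mnm1_eq0 mul0r one0 => /eqP.
  by rewrite eq_sym oner_eq0.
- move=> h1 h0; exfalso; rewrite h1 mulrCA -{2}[fX 0]mulr1 in h0.
  have := congr1 (fun f : fps K 2 => f 0%MM) (fX_inj h0).
  by rewrite coeffs0M H0 mul0r one0 => /eqP; rewrite eq_sym oner_eq0.
- move=> h1 h0; rewrite h1 ![_ * fX 1]mulrC in h0.
  by split=> //; apply: fmap2P => //; exact: fX_inj h0.
Qed.

Lemma lift_total F d : exists u : direction K * fmap K 2 2,
  formal_diffeo F -> lifts F d u.1 u.2.
Proof.
case: (pselect (formal_diffeo F)) => [/(lift_exists d)[d' [G h]]|h].
  by exists (d', G).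
by exists (d, F).
Qed.

Definition lift_dir F d : direction K := (projT1 (cid (lift_total F d))).1.
Definition lift_map F d : fmap K 2 2 := (projT1 (cid (lift_total F d))).2.

Lemma liftP F d : formal_diffeo F -> lifts F d (lift_dir F d) (lift_map F d).
Proof. exact: (projT2 (cid (lift_total F d))). Qed.

Lemma lift_inverse F G d : formal_diffeo F -> formal_diffeo G ->
  fcomp G F = @fid K 2 ->
  lift_dir G (lift_dir F d) = d /\
  fcomp (lift_map G (lift_dir F d)) (lift_map F d) = @fid K 2.
Proof.
move=> dF dG GF; have [f0 fE _] := liftP d dF.
have [g0 gE _] := liftP (lift_dir F d) dG.
have cc := centered_chart.
apply: chart_cancel; first exact: centered_comp.
rewrite -(fcompA _ g0 f0) -gE (fcompA _ (cc _) f0) -fE -(fcompA _ dF.1 (cc d)).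
by rewrite GF fcomp_id_l.
Qed.

(** By uniqueness, the lifts of [F] and of its inverse are inverse to each
    other. *)
Lemma diffeo_lift F d : formal_diffeo F -> formal_diffeo (lift_map F d).
Proof.
move=> dF; have [G [dG _ GF]] := formal_diffeo_inverse dF.
have [_ h] := lift_inverse d dF dG GF.
have [f0 _ _] := liftP d dF; have [g0 _ _] := liftP (lift_dir F d) dG.
by have [] := diffeo_of_inverse g0 f0 h.
Qed.

Lemma lift_exc_line F d : formal_diffeo F ->
  exists2 phi : fmap K 1 1, formal_diffeo phi &
    fcomp (lift_map F d) (exc_line d) = fcomp (exc_line (lift_dir F d)) phi.
Proof.
move=> dF; have [G0 _ ex] := liftP d dF; have [_ JG] := diffeo_lift d dF.
set G := lift_map F d in G0 ex JG *; set d' := lift_dir F d in ex *.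
have ce := centered_exc_line.
pose phi : fmap K 1 1 := fun _ => fps_subst (G (other_coord d')) (exc_line d).
have phi0 : centered phi.
  by move=> i; rewrite /phi subst_coef0.
have E : fcomp G (exc_line d) = fcomp (exc_line d') phi.
  apply: fmap2P; rewrite /fcomp [exc_line d']exc_lineE; move: ex; rewrite /phi.
    by case: d' @phi phi0 => [c|] phi phi0 ex /=; rewrite ?subst0 ?substX.
  by case: d' @phi phi0 => [c|] phi phi0 ex /=; rewrite ?subst0 ?substX.
exists phi => //; split=> //; rewrite unitmxE det_mx11 unitfE.
apply/negP => /eqP p0; have := congr1 (@jacobian K 2 1) E.
rewrite (jacobian_comp _ (ce d)) (jacobian_comp _ phi0).
have -> : jacobian phi = 0 by apply/matrixP => i j; rewrite !ord1 p0 mxE.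
rewrite mulmx0 => h.
have : jacobian (exc_line d) = 0 by rewrite -[LHS]mul1mx -(mulVmx JG) -mulmxA h mulmx0.
move=> /matrixP/(_ (other_coord d) 0); rewrite !mxE exc_lineE.
rewrite (_ : (_ == _) = false); last by case: d {ex G E phi phi0 p0 G0 JG h d'}.
by rewrite coeffsX eqxx => /eqP; rewrite oner_eq0.
Qed.

Fixpoint tree_map (F : fmap K 2 2) (p : inf_near K) : inf_near K :=
  if p is d :: s then lift_dir F d :: tree_map (lift_map F d) s else [::].

Fixpoint tree_lift (F : fmap K 2 2) (p : inf_near K) : fmap K 2 2 :=
  if p is d :: s then tree_lift (lift_map F d) s else F.

Lemma diffeo_tree_lift F p : formal_diffeo F -> formal_diffeo (tree_lift F p).
Proof. by elim: p F => //= d s IH F dF; apply/IH/diffeo_lift. Qed.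

Lemma tree_map_cat F p q :
  tree_map F (p ++ q) = tree_map F p ++ tree_map (tree_lift F p) q.
Proof. by elim: p F => //= d p IH F; rewrite IH. Qed.

Lemma tree_lift_cat F p q : tree_lift F (p ++ q) = tree_lift (tree_lift F p) q.
Proof. by elim: p F => //= d p IH F; rewrite IH. Qed.

Lemma tree_map_prefix F : {homo tree_map F : p q / prefix p q}.
Proof. by move=> p q /prefixP[s ->]; rewrite tree_map_cat prefix_prefix. Qed.

Lemma tree_mapK F G : formal_diffeo F -> formal_diffeo G ->
  fcomp G F = @fid K 2 -> cancel (tree_map F) (tree_map G).
Proof.
move=> dF dG GF p; elim: p F G dF dG GF => //= d s IH F G dF dG GF.
have [-> h] := lift_inverse d dF dG GF.
by rewrite IH //; apply: diffeo_lift.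
Qed.

Lemma centered_blowdown p (t : fmap K 2 1) : centered t -> centered (blowdown p t).
Proof.
by elim: p => //= d s IH t0; apply: centered_comp; apply: centered_chart.
Qed.

Lemma blowdown_comp p (t : fmap K 2 1) (u : fmap K 1 1) : centered t -> centered u ->
  blowdown p (fcomp t u) = fcomp (blowdown p t) u.
Proof.
move=> t0 u0; elim: p => //= d s ->; rewrite fcompA //.
exact: centered_blowdown.
Qed.

Lemma blowdown_tree F p (t : fmap K 2 1) : formal_diffeo F -> centered t ->
  fcomp F (blowdown p t) = blowdown (tree_map F p) (fcomp (tree_lift F p) t).
Proof.
move=> dF t0; elim: p F dF => [|d s IH] F dF; first exact: erefl.
have [G0 e _] := liftP d dF; have b0 := centered_blowdown s t0.
transitivity (fcomp (chart (lift_dir F d)) (fcomp (lift_map F d) (blowdown s t))).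
  by rewrite -(fcompA _ G0 b0) -e; apply/esym/fcompA; first exact: centered_chart.
by rewrite (IH _ (diffeo_lift d dF)).
Qed.

(** The lift of [F] at [p] transports the germs of branches and of exceptional
    lines at [p], up to a reparametrization [psi] that restores the prescribed
    parametrization. *)
Lemma formal_equivalence_carries r (C C' : 'I_r -> fmap K 2 1) F
    (phi : 'I_r -> fmap K 1 1) :
  formal_diffeo F -> (forall i, centered (C i)) ->
  (forall i, formal_diffeo (phi i)) ->
  (forall i, fcomp F (C i) = fcomp (C' i) (phi i)) ->
  carries C C' id (tree_map F).
Proof.
move=> dF C0 dphi E.
have [G [dG FG GF]] := formal_diffeo_inverse dF.
pose R p (x y : 'cV[K]_2) := exists2 c : K, c != 0 &
  y = c *: (jacobian (tree_lift F p) *m x).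
apply: (@carries_of_germs _ _ _ _ _ _ _ R) => //.
- exact: can_inj (tree_mapK dF dG GF).
- move=> p x x' [c _ ->]; apply: contra_neq => ->.
  by rewrite mulmx0 scaler0.
- move=> p x x' y y' [c _ ->] [c' _ ->]; apply: contra_neq.
  by move=> h; rewrite det_row_mx2_mul h !mulr0.
have tr A p t : germ_at C A p t -> exists2 psi : fmap K 1 1, formal_diffeo psi &
    germ_at C' (map_divisor id (tree_map F) A) (tree_map F p)
      (fcomp (fcomp (tree_lift F p) t) psi).
  have [l0 _] := diffeo_tree_lift p dF.
  move=> [t0]; case: A => [i|q] /= h.
    have [psi [dpsi pp _]] := formal_diffeo_inverse (dphi i).
    exists psi => //; split; first by do 2!apply: centered_comp.
    move=> j m; have p0 := dpsi.1; have ph0 := (dphi i).1.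
    rewrite blowdown_comp //; last exact: centered_comp.
    rewrite -blowdown_tree // (fmapP h) E fcompA // pp fcomp_id_r //.
  have [d [s [pE h']]] := h.
  set F' := lift_map (tree_lift F q) d.
  have dF' : formal_diffeo F' by apply/diffeo_lift/diffeo_tree_lift.
  have [phi' dphi' eE] := lift_exc_line d (diffeo_tree_lift q dF).
  have [psi [dpsi pp _]] := formal_diffeo_inverse dphi'.
  have p0 := dpsi.1; have ph0 := dphi'.1.
  exists psi => //; split; first by do 2!apply: centered_comp.
  exists (lift_dir (tree_lift F q) d), (tree_map F' s); split.
    by rewrite pE tree_map_cat.
  move=> j m; rewrite pE tree_lift_cat /= -/F'.
  have l0' := (diffeo_tree_lift s dF').1.
  rewrite blowdown_comp //; last exact: centered_comp.
  by rewrite -blowdown_tree // (fmapP h') eE fcompA // pp fcomp_id_r.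
move=> A p t gt; have [psi [p0 Jpsi] gt'] := tr _ _ _ gt.
exists (fcomp (fcomp (tree_lift F p) t) psi); split=> //.
exists (jacobian psi 0 0).
  by move: Jpsi; rewrite unitmxE det_mx11 unitfE.
have [t0 _] := gt; rewrite !jacobian_comp // {1}[jacobian psi]mx11_scalar.
by rewrite mul_mx_scalar.
Qed.

Lemma formal_equivalence_tree_iso r (C C' : 'I_r -> fmap K 2 1) F
    (phi : 'I_r -> fmap K 1 1) :
  formal_diffeo F -> (forall i, centered (C i)) -> (forall i, centered (C' i)) ->
  (forall i, formal_diffeo (phi i)) ->
  (forall i, fcomp F (C i) = fcomp (C' i) (phi i)) ->
  tree_iso C C' id.
Proof.
move=> dF C0 C0' dphi E.
have [G [dG FG GF]] := formal_diffeo_inverse dF.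
have [psi hpsi] := choice (fun i => formal_diffeo_inverse (dphi i)).
have dpsi i : formal_diffeo (psi i) by have [] := hpsi i.
exists id, (tree_map F), (tree_map G); split=> //.
- by split; apply: tree_mapK.
- by split; apply: tree_map_prefix.
- exact: formal_equivalence_carries E.
apply: (@formal_equivalence_carries _ _ _ _ psi) => // i.
have [_ pp _] := hpsi i.
have c1 := (dpsi i).1; have c2 := (dphi i).1.
have e : C' i = fcomp (fcomp F (C i)) (psi i).
  by rewrite E (fcompA _ c2 c1) pp fcomp_id_r.
rewrite e -(fcompA _ (centered_comp (C i) dF.1) c1) -(fcompA _ dF.1 (C0 i)).
by rewrite GF (fcomp_id_l (C0 i)).
Qed.

End BlowUp.

(** * Conjugate curves *)

Section Conjugation.
Variables (K : fieldType) (theta : {rmorphism K -> K}).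
Hypothesis thetaK : involutive theta.

Let k : inf_near K -> inf_near K := map (omap theta).

Lemma fmap_map_chart d : fmap_map theta (chart d) = chart (omap theta d).
Proof.
apply: fmap2P; rewrite /fmap_map ?chart0 ?chart1.
  by case: d => [c|] /=; rewrite ?fps_mapM !fps_mapX.
by case: d => [c|] /=; rewrite ?fps_mapM ?fps_mapD ?fps_mapC !fps_mapX.
Qed.

Lemma fmap_map_exc_line d :
  fmap_map theta (exc_line d) = exc_line (omap theta d).
Proof.
rewrite !exc_lineE; apply: funext => i; rewrite /fmap_map.
by case: d => [c|] /=; case: ifP => _; rewrite ?fps_map0 ?fps_mapX.
Qed.

Lemma fmap_map_blowdown p t :
  fmap_map theta (blowdown p t) = blowdown (k p) (fmap_map theta t).
Proof. by elim: p => //= d s <-; rewrite fmap_map_comp fmap_map_chart. Qed.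

Lemma conjugation_carries r (C : 'I_r -> fmap K 2 1) :
  carries C (fun i => fmap_map theta (C i)) id k.
Proof.
apply: (@carries_of_germs _ _ _ _ _ _ _ (fun _ x y => y = map_mx theta x)) => //.
- by apply/inj_map/inj_omap/fmorph_inj.
- by move=> p x x' ->; rewrite map_mx_eq0.
- move=> p x x' y y' -> ->; apply: contra_neq; rewrite !det_row_mx2 => h.
  by rewrite !mxE -!rmorphM -rmorphB h rmorph0.
move=> A p t [t0 h]; exists (fmap_map theta t); split; last exact: jacobian_map.
split; first exact: centered_map.
case: A h => [i|q] /= h.
  by move=> j m; rewrite -fmap_map_blowdown (fmapP h).
have [d [s [-> h']]] := h; exists (omap theta d), (k s); split.
  by rewrite /k map_cat.
by move=> j m; rewrite -fmap_map_blowdown (fmapP h') fmap_map_exc_line.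
Qed.

Lemma conjugation_tree_iso r (C : 'I_r -> fmap K 2 1) :
  tree_iso C (fun i => fmap_map theta (C i)) id.
Proof.
have kK : cancel k k.
  by apply: mapK => d; case: d => //= c; rewrite thetaK.
have kp : {homo k : p q / prefix p q}.
  by move=> p q /prefixP[s ->]; rewrite /k map_cat prefix_prefix.
exists id, k, k; split=> //; first exact: conjugation_carries.
have e : (fun i => fmap_map theta (fmap_map theta (C i))) = C.
  apply: funext => i; apply: fmapP => j m.
  by rewrite /fmap_map /fps_map thetaK.
by have := conjugation_carries (fun i => fmap_map theta (C i)); rewrite e.
Qed.

End Conjugation.

(** * Families of graphs with the same orders of contact *)

Section Transposition.
Variable T : eqType.

(** The correspondence [a i |-> b i] is extended one index at a time, correcting
    the permutation already found by a transposition. *)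
Lemma extend_bijection (I : eqType) (s : seq I) (a b : I -> T) :
  {in s &, forall i j, (a i == a j) = (b i == b j)} ->
  exists u : (T -> T) * (T -> T),
    [/\ cancel u.1 u.2, cancel u.2 u.1 & {in s, forall i, u.1 (a i) = b i}].
Proof.
elim: s => [|i s IH] h; first by exists (id, id).
have [|[f f'] /= [fK fK' fE]] := IH.
  by move=> j l js ls; apply: h; rewrite inE ?js ?ls orbT.
have [/hasP[j js /eqP aij]|/hasPn ns] := boolP (has (fun j => a i == a j) s).
  exists (f, f'); split=> // l; rewrite inE => /orP[/eqP -> /=|]; last exact: fE.
  rewrite aij fE //; apply/esym/eqP.
  by rewrite -h ?aij ?inE ?eqxx ?js ?orbT.
pose sw x := if x == f (a i) then b i else if x == b i then f (a i) else x.
have swK : involutive sw.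
  move=> x; rewrite /sw; case: (eqVneq x (f (a i))) => [->|h1].
    by case: (eqVneq (b i) (f (a i))) => [//|_]; rewrite eqxx.
  case: (eqVneq x (b i)) => [->|h2]; first by rewrite eqxx.
  by rewrite (negPf h1) (negPf h2).
exists (sw \o f, f' \o sw); split=> /=.
- exact: can_comp swK fK.
- exact: can_comp fK' swK.
move=> l; rewrite inE => /orP[/eqP ->|ls]; first by rewrite /sw /= eqxx.
rewrite /= fE // /sw -(fE _ ls) (can_eq fK) eq_sym (negPf (ns _ ls)) fE //.
by rewrite eq_sym -h ?(negPf (ns _ ls)) // inE ?eqxx ?ls ?orbT.
Qed.

End Transposition.

Section Graphs.
Variable K : fieldType.

Definition graph (g : fps K 1) : fmap K 2 1 := fun i => if i == 0 then fX 0 else g.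

(** The ordinate of the strict transform of the graph of [g] under the blow-up
    of the origin. *)
Definition blow_graph (g : fps K 1) : fps K 1 := quotX 0 g - fC (g U_(0%R)%MM).

(** This is the Taylor coefficient of order [n.+1] of [g], see [slope_coef]. *)
Definition slope n (g : fps K 1) : K := iter n blow_graph g U_(0%R)%MM.

(** The sequence of points infinitely near to the origin on the graph of [g]. *)
Definition graph_path (g : fps K 1) n : inf_near K := mkseq (fun l => Some (slope l g)) n.

Lemma centered_graph g : g 0%MM = 0 -> centered (graph g).
Proof. by move=> g0 i; rewrite /graph; case: ifP => // _; rewrite coeffsX mnm1_eq0. Qed.

Lemma blow_graph0 g : blow_graph g 0%MM = 0.
Proof. by rewrite /blow_graph coeffsB quotX0 coeffsC eqxx mulr1 subrr. Qed.

Lemma blow_graphE g : g 0%MM = 0 ->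
  g = fX 0 * (fC (g U_(0%R)%MM) + blow_graph g).
Proof.
move=> g0; rewrite /blow_graph addrC subrK {1}[g]divX // big_ord1.
by [].
Qed.

Lemma chart_graph d t g : centered t -> g 0%MM = 0 ->
  fcomp (chart d) t = graph g <->
  d = Some (g U_(0%R)%MM) /\ t = graph (blow_graph g).
Proof.
move=> t0 g0; split=> [h|[-> ->]]; last first.
  have c0 := centered_graph (blow_graph0 g).
  apply: fmap2P; rewrite /fcomp ?chart0 ?chart1 ?substM ?substD ?substC ?substX //.
  by rewrite /graph /= {3}[g]blow_graphE.
have := congr1 (fun G => G 0) h; have := congr1 (fun G => G 1) h.
rewrite /fcomp /graph !chart0 !chart1 {h} /=.
case: d => [c|]; rewrite ?(substM, substD, substX, substC) //.
  move=> h1 h0; rewrite h0 (blow_graphE g0) in h1; have h2 := fX_inj h1.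
  have cc : c = g U_(0%R)%MM.
    have := congr1 (fun f : fps K 1 => f 0%MM) h2.
    by rewrite !coeffsD t0 blow_graph0 !coeffsC eqxx !addr0 !mulr1.
  rewrite cc in h2 *; split=> //; apply: fmap2P => //=.
  exact: addrI h2.
move=> _ h0; exfalso; have := congr1 (fun f : fps K 1 => f U_(0%R)%MM) h0.
by rewrite coeffsUM !t0 mul0r mulr0 addr0 coeffsX eqxx => /eqP; rewrite eq_sym oner_eq0.
Qed.

Lemma blowdown_graph p t g : centered t -> g 0%MM = 0 ->
  blowdown p t = graph g <->
  p = graph_path g (size p) /\ t = graph (iter (size p) blow_graph g).
Proof.
move=> t0; elim: p g => [|d s IH] g g0; first by split=> [|[]].
have b0 := centered_blowdown s t0.
have pathS : graph_path g (size s).+1 =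
    Some (g U_(0%R)%MM) :: graph_path (blow_graph g) (size s).
  rewrite /graph_path /mkseq /= (iotaDl 1 0) -map_comp; congr (_ :: _).
  by apply: eq_map => l; rewrite /slope /= -iterSr.
rewrite [size _]/= pathS iterSr.
have := chart_graph d b0 g0; rewrite -[fcomp _ _]/(blowdown (d :: s) t) => ->.
rewrite IH ?blow_graph0 //.
by split=> [[-> [h1 h2]]|[[-> h1] h2]]; split; rewrite // -h1.
Qed.

Lemma exc_line_None : exc_line None = graph 0.
Proof. by rewrite exc_lineE; apply: fmap2P. Qed.

Definition vertical : fmap K 2 1 := exc_line (Some 0).

Lemma exc_line_Some c : exc_line (Some c) = vertical.
Proof. by rewrite /vertical !exc_lineE. Qed.

Lemma chart_vertical d t : centered t ->
  fcomp (chart d) t = vertical <-> d = None /\ t = vertical.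
Proof.
move=> t0; rewrite /vertical exc_lineE; split=> [h|[-> ->]]; last first.
  have c0 := @centered_exc_line K (Some 0); rewrite exc_lineE in c0.
  apply: fmap2P; rewrite /fcomp ?chart0 ?chart1 ?substM ?substX //=.
  by rewrite mul0r.
have := congr1 (fun G => G 0) h; have := congr1 (fun G => G 1) h.
rewrite /fcomp !chart0 !chart1 {h} /=.
case: d => [c|]; rewrite ?(substM, substD, substX, substC) //.
  move=> h1 h0; exfalso; move: h1; rewrite h0 mul0r.
  move=> /(congr1 (fun f : fps K 1 => f U_(0%R)%MM)).
  by rewrite coeffsX eqxx coeffs0 => /eqP; rewrite eq_sym oner_eq0.
move=> h1 h0; split=> //; apply: fmap2P => //=.
by apply: (@fX_inj _ _ 0); rewrite mulr0 -h0 h1 mulrC.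
Qed.

Lemma blowdown_vertical p t : centered t ->
  blowdown p t = vertical <-> p = nseq (size p) None /\ t = vertical.
Proof.
move=> t0; elim: p => [|d s IH]; first by split=> [|[]].
have b0 := centered_blowdown s t0.
have := chart_vertical d b0; rewrite -[fcomp _ _]/(blowdown (d :: s) t) => ->.
rewrite IH /=; split=> [[-> [h1 h2]]|[[-> h1] h2]]; split; rewrite // -?h1 //.
Qed.

(** The direction of the exceptional line in the chart centred at [d]; all the
    later points of its strict transform have the same direction. *)
Definition exc_dir (d : direction K) : direction K :=
  if d is Some _ then None else Some 0.

Lemma iter_blow0 n : iter n blow_graph 0 = 0.
Proof.
elim: n => //= n ->; rewrite /blow_graph coeffs0 fC0 subr0.
by apply: fpsP => a; rewrite /quotX !coeffs0 if_same.
Qed.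

Lemma graph_path0 n : graph_path 0 n = nseq n (Some 0).
Proof.
apply: (@eq_from_nth _ None) => [|i]; rewrite size_mkseq ?size_nseq // => hi.
by rewrite nth_mkseq // nth_nseq hi /slope iter_blow0.
Qed.

Lemma blowdown_exc_line p t d : centered t ->
  blowdown p t = exc_line d <->
  p = nseq (size p) (exc_dir d) /\ t = exc_line d.
Proof.
move=> t0; case: d => [c|]; first by rewrite exc_line_Some; apply: blowdown_vertical.
rewrite exc_line_None blowdown_graph // graph_path0 iter_blow0.
by [].
Qed.

Section Family.
Variables (r : nat) (g : 'I_r -> fps K 1).
Hypothesis g0 : forall i, g i 0%MM = 0.
Let C i := graph (g i).

Lemma germ_branch i p t : germ_at C (Branch K i) p t <->
  p = graph_path (g i) (size p) /\ t = graph (iter (size p) blow_graph (g i)).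
Proof.
split=> [[t0 /= h]|[h1 h2]].
  by apply/(blowdown_graph p t0 (g0 i)); apply: fmapP.
have t0 : centered t.
  rewrite h2; apply: centered_graph; case: (size p) => [|n] /=; first exact: g0.
  exact: blow_graph0.
split=> //= j m; rewrite (_ : blowdown p t = C i) //.
exact/(blowdown_graph p t0 (g0 i)).
Qed.

Lemma germ_exc q p t : germ_at C (Exc r q) p t <->
  exists d s, [/\ p = q ++ d :: s, s = nseq (size s) (exc_dir d)
                & t = exc_line d].
Proof.
split=> [[t0 /= [d [s [pE h]]]]|[d [s [pE sE tE]]]].
  exists d, s; have [] := proj1 (blowdown_exc_line s d t0) (fmapP h).
  by split.
have t0 : centered t by rewrite tE; apply: centered_exc_line.
split=> //=; exists d, s; split=> // j m; rewrite (_ : blowdown s t = exc_line d) //.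
exact/(blowdown_exc_line s d t0).
Qed.

Lemma passes_branch i p : passes C (Branch K i) p <-> p = graph_path (g i) (size p).
Proof.
split=> [[t /germ_branch[]//]|h].
by exists (graph (iter (size p) blow_graph (g i))); apply/germ_branch.
Qed.

Lemma passes_exc q p : passes C (Exc r q) p <->
  exists d s, p = q ++ d :: s /\ s = nseq (size s) (exc_dir d).
Proof.
split=> [[t /germ_exc[d [s []]]]|[d [s [h1 h2]]]]; first by exists d, s.
by exists (exc_line d); apply/germ_exc; exists d, s.
Qed.

Definition dir_vec (d : direction K) : 'cV[K]_2 :=
  \col_i if i == exc_coord d then 1 else if d is Some c then c else 0.

Lemma jacobian_graph h : jacobian (graph h) = dir_vec (Some (h U_(0%R)%MM)).
Proof.
apply/matrixP => i j; rewrite !mxE !ord1 /graph /=; case: ifP => // _.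
by rewrite coeffsX eqxx.
Qed.

Lemma graph_pathS h n : graph_path h n.+1 = rcons (graph_path h n) (Some (slope n h)).
Proof. by rewrite /graph_path /mkseq -{1}[n.+1]addn1 iotaD map_cat cats1. Qed.

(** The tangent of a germ is the unique next point through which its divisor
    passes. *)
Lemma germ_dir A p t : germ_at C A p t -> exists d,
  [/\ passes C A (rcons p d), jacobian t = dir_vec d
    & forall d', passes C A (rcons p d') -> d' = d].
Proof.
case: A => [i /germ_branch[pE ->]|q /germ_exc[d [s [pE sE ->]]]].
  exists (Some (slope (size p) (g i))); split; last 1 first.
  - move=> d' /passes_branch; rewrite size_rcons graph_pathS => h.
    by have := congr1 (last None) h; rewrite !last_rcons.
  - by apply/passes_branch; rewrite size_rcons graph_pathS -pE.
  - exact: jacobian_graph.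
exists (exc_dir d); split.
- apply/passes_exc; exists d, (rcons s (exc_dir d)).
  split; first by rewrite pE -!cats1 -catA.
  by rewrite size_rcons -cats1 {1}sE -[(size s).+1]addn1 nseqD.
- apply/matrixP => i j; rewrite !mxE exc_lineE !ord1.
  case: d {pE sE} => [c|] /=; case: i => -[|[|//]] hi //=;
    by rewrite ?coeffs0 ?coeffsX ?eqxx.
move=> d' /passes_exc[d2 [s2 [h hs]]].
have e : d :: rcons s d' = d2 :: s2.
  move: h; rewrite pE -cats1 -catA => /eqP; rewrite eqseq_cat // eqxx /=.
  by rewrite cats1 => /eqP.
case: e hs => <- <-; rewrite size_rcons -[(size s).+1]addn1 nseqD cats1.
by move=> /(congr1 (last None)); rewrite !last_rcons.
Qed.

Lemma det_dir_vec d d' : d != d' -> \det (row_mx (dir_vec d) (dir_vec d') : 'M_2) != 0.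
Proof.
rewrite det_row_mx2 !mxE; case: d d' => [c|] [c'|] //=.
- by rewrite (inj_eq Some_inj) !mul1r subr_eq0 eq_sym.
- by move=> _; rewrite mul1r mul0r subr0 oner_eq0.
- by move=> _; rewrite mul0r mul1r sub0r oppr_eq0 oner_eq0.
Qed.

Lemma dir_vec_neq0 d : dir_vec d != 0.
Proof.
apply/negP => /eqP/matrixP/(_ (exc_coord d) 0).
by rewrite !mxE eqxx => /eqP; rewrite oner_eq0.
Qed.

End Family.

(** For families of graphs, normal crossings can be read off the divisors
    passing through each point, as these have the tangents of the germs as
    next directions. *)
Lemma graphs_carries r (g g' : 'I_r -> fps K 1) (k : inf_near K -> inf_near K) :
  (forall i, g i 0%MM = 0) -> (forall i, g' i 0%MM = 0) -> injective k ->
  (forall p d, exists d', k (rcons p d) = rcons (k p) d') ->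
  (forall A p, passes (fun i => graph (g i)) A p ->
     passes (fun i => graph (g' i)) (map_divisor id k A) (k p)) ->
  carries (fun i => graph (g i)) (fun i => graph (g' i)) id k.
Proof.
move=> g0 g0' ik kr pa; split=> // p [_ tr two].
have inj : injective (@map_divisor K r r id k).
  by move=> [i|q] [j|q'] //= [/ik ->].
split.
- by move=> A t /(germ_dir g0)[d [_ -> _]]; exact: dir_vec_neq0.
- move=> A B t t' AB gA gB.
  have [d [dA -> _]] := germ_dir g0 gA; have [d' [dB -> _]] := germ_dir g0 gB.
  have [dd|] := eqVneq d d'; last exact: det_dir_vec.
  exfalso; rewrite -dd {d' dd} in dB; have [d' kd] := kr p d.
  have [u gu] := pa _ _ (ex_intro _ _ gA).
  have [u' gu'] := pa _ _ (ex_intro _ _ gB).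
  have nAB : map_divisor id k A <> map_divisor id k B by move=> /inj.
  have := tr _ _ _ _ nAB gu gu'.
  have [e [_ -> eu]] := germ_dir g0' gu; have [e' [_ -> eu']] := germ_dir g0' gu'.
  have ed : d' = e by apply: eu; rewrite -kd; apply: pa.
  have ed' : d' = e' by apply: eu'; rewrite -kd; apply: pa.
  by rewrite -ed -ed' det_row_mx2 mulrC subrr eqxx.
move=> A B D /pa hA /pa hB /pa hD.
by case: (two _ _ _ hA hB hD) => /inj e; [apply: Or31|apply: Or32|apply: Or33].
Qed.

Section SameContact.
Variables (r : nat) (g g' : 'I_r -> fps K 1).
Hypotheses (g0 : forall i, g i 0%MM = 0) (g0' : forall i, g' i 0%MM = 0).
Hypothesis contact : forall i j n,
  graph_path (g i) n = graph_path (g j) n <->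
  graph_path (g' i) n = graph_path (g' j) n.

Let on p (i : 'I_r) := graph_path (g i) (size p) == p.

(** On nodes met by a branch the directions of the branches leaving the node are
    matched; such nodes have no direction [None]. The other nodes are left
    alone, which preserves the directions [Some 0] followed by exceptional
    lines. *)
Lemma node_permutation p : exists u : (K -> K) * (K -> K),
  [/\ cancel u.1 u.2, cancel u.2 u.1,
      forall i, on p i -> u.1 (slope (size p) (g i)) = slope (size p) (g' i)
    & (forall i, ~~ on p i) -> u = (id, id)].
Proof.
case: (pselect (forall i, ~~ on p i)) => [h|h].
  by exists (id, id); split=> // i; rewrite (negPf (h i)).
have [|u [u1 u2 u3]] := @extend_bijection _ _ [seq i <- enum 'I_r | on p i]
   (fun i => slope (size p) (g i)) (fun i => slope (size p) (g' i)).
  move=> i j; rewrite !mem_filter => /andP[/eqP hi _] /andP[/eqP hj _].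
  have eqS f f' n : graph_path f n = graph_path f' n ->
      graph_path f n.+1 = graph_path f' n.+1 <-> slope n f = slope n f'.
    move=> e; rewrite !graph_pathS e; split=> [|->//].
    by move=> /(congr1 (last None)); rewrite !last_rcons => -[].
  have e : graph_path (g i) (size p) = graph_path (g j) (size p) by rewrite hi hj.
  have e' := proj1 (contact i j _) e.
  apply/eqP/eqP => h'; first by apply/(eqS _ _ _ e')/contact/(eqS _ _ _ e).
  by apply/(eqS _ _ _ e)/contact/(eqS _ _ _ e').
exists u; split=> // i oni; apply: u3.
by rewrite mem_filter oni mem_enum.
Qed.

Let rho p := projT1 (cid (node_permutation p)).

Lemma rho_slope p i : on p i ->
  (rho p).1 (slope (size p) (g i)) = slope (size p) (g' i).
Proof. by have [_ _ h _] := projT2 (cid (node_permutation p)); apply: h. Qed.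

Lemma rho_path i n :
  (rho (graph_path (g i) n)).1 (slope n (g i)) = slope n (g' i).
Proof.
set p := graph_path _ _; have sp : size p = n by rewrite /p size_mkseq.
have onp : on p i by rewrite /on sp.
by have := rho_slope onp; rewrite sp.
Qed.

(** The node [pre] at which the directions are permuted is a node of the source
    tree, both for [relabel] and for its inverse [unlabel]. *)
Fixpoint relabel pre (p : inf_near K) : inf_near K :=
  if p is d :: s then omap (rho pre).1 d :: relabel (rcons pre d) s else [::].

Fixpoint unlabel pre (p : inf_near K) : inf_near K :=
  if p is d :: s then
    let e := omap (rho pre).2 d in e :: unlabel (rcons pre e) s
  else [::].

Lemma relabelK pre : cancel (relabel pre) (unlabel pre).
Proof.
move=> p; elim: p pre => //= d s IH pre.
have [h _ _ _] := projT2 (cid (node_permutation pre)).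
have -> : omap (rho pre).2 (omap (rho pre).1 d) = d by case: d => //= c; rewrite h.
by rewrite IH.
Qed.

Lemma unlabelK pre : cancel (unlabel pre) (relabel pre).
Proof.
move=> p; elim: p pre => //= d s IH pre.
have [_ h _ _] := projT2 (cid (node_permutation pre)).
have -> : omap (rho pre).1 (omap (rho pre).2 d) = d by case: d => //= c; rewrite h.
by rewrite IH.
Qed.

Lemma relabel_cat pre p q :
  relabel pre (p ++ q) = relabel pre p ++ relabel (pre ++ p) q.
Proof.
elim: p pre => [|d s IH] pre /=; first by rewrite cats0.
by rewrite IH cat_rcons.
Qed.

Lemma unlabel_cat pre p q :
  unlabel pre (p ++ q) = unlabel pre p ++ unlabel (pre ++ unlabel pre p) q.
Proof.
elim: p pre => [|d s IH] pre /=; first by rewrite cats0.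
by rewrite IH cat_rcons.
Qed.

Lemma off_tree pre : None \in pre -> rho pre = (id, id).
Proof.
move=> h; have [_ _ _] := projT2 (cid (node_permutation pre)); apply=> i.
apply/negP => /eqP e; move: h; rewrite -e => /mapP[l _].
by [].
Qed.

Lemma relabel_off pre p : None \in pre -> relabel pre p = p.
Proof.
elim: p pre => //= d s IH pre h; rewrite off_tree //= IH; first by case: d.
by rewrite mem_rcons inE h orbT.
Qed.

Lemma unlabel_off pre p : None \in pre -> unlabel pre p = p.
Proof.
elim: p pre => //= d s IH pre h; rewrite off_tree //=.
have -> : omap id d = d by case: d.
by rewrite IH // mem_rcons inE h orbT.
Qed.

Lemma relabel_None pre n : relabel pre (nseq n None) = nseq n None.
Proof. by elim: n pre => //= n IH pre; rewrite IH. Qed.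

Lemma unlabel_None pre n : unlabel pre (nseq n None) = nseq n None.
Proof. by elim: n pre => //= n IH pre; rewrite IH. Qed.

Lemma relabel_path i n : relabel [::] (graph_path (g i) n) = graph_path (g' i) n.
Proof.
elim: n => // n IH; rewrite !graph_pathS -!cats1 relabel_cat IH /=.
by rewrite rho_path.
Qed.

Lemma relabel_passes A p : passes (fun i => graph (g i)) A p ->
  passes (fun i => graph (g' i)) (map_divisor id (relabel [::]) A) (relabel [::] p).
Proof.
case: A => [i /(passes_branch g0)|q /(passes_exc g)] h.
  by apply/(passes_branch g0'); rewrite h relabel_path !size_mkseq.
apply/(passes_exc g'); have [d [s [-> ->]]] := h.
rewrite relabel_cat /=; case: d {h} => [c|] /=.
  eexists; eexists; split; first reflexivity.
  by rewrite relabel_None !size_nseq.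
have cNone : None \in rcons (q) (None : direction K) by rewrite mem_rcons inE.
exists None, (nseq (size s) (Some 0)).
by rewrite size_nseq (relabel_off _ cNone).
Qed.

Lemma unlabel_passes A p : passes (fun i => graph (g' i)) A p ->
  passes (fun i => graph (g i)) (map_divisor id (unlabel [::]) A) (unlabel [::] p).
Proof.
case: A => [i /(passes_branch g0')|q /(passes_exc g')] h.
  by apply/(passes_branch g0); rewrite h -relabel_path relabelK !size_mkseq.
apply/(passes_exc g); have [d [s [-> ->]]] := h.
rewrite unlabel_cat /=; case: d {h} => [c|] /=.
  eexists; eexists; split; first reflexivity.
  by rewrite unlabel_None !size_nseq.
have cNone : None \in rcons (unlabel [::] q) (None : direction K) by rewrite mem_rcons inE.
exists None, (nseq (size s) (Some 0)).
by rewrite size_nseq (unlabel_off _ cNone).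
Qed.

Lemma same_contact_tree_iso :
  tree_iso (fun i => graph (g i)) (fun i => graph (g' i)) id.
Proof.
exists id, (relabel [::]), (unlabel [::]); split=> //.
- by split; [apply: relabelK|apply: unlabelK].
- by split=> p q /prefixP[s ->]; rewrite ?relabel_cat ?unlabel_cat prefix_prefix.
- apply: graphs_carries => //; first exact: can_inj (@relabelK _).
    by move=> p d; eexists; rewrite -!cats1 relabel_cat.
  exact: relabel_passes.
apply: graphs_carries => //; first exact: can_inj (@unlabelK _).
  by move=> p d; eexists; rewrite -!cats1 unlabel_cat.
exact: unlabel_passes.
Qed.

End SameContact.
End Graphs.

(** * Derivative transverse to an axis *)

Section Plane.
Variable K : fieldType.

(** The inclusion of the axis [w = 0] in the plane with coordinates [(z, w)]. *)
Definition axis : fmap K 2 1 := fun i => if i == 0 then fX 0 else 0.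

Definition fcoord n (i : 'I_n) : fmap K 1 n := fun _ => fX i.

Lemma centered_axis : centered axis.
Proof. by move=> i; rewrite /axis; case: ifP => // _; rewrite coeffsX mnm1_eq0. Qed.

Lemma centered_fcoord n (i : 'I_n) : centered (fcoord i).
Proof. by move=> j; rewrite /fcoord coeffsX mnm1_eq0. Qed.

Lemma fcoord_axis : fcomp (fcoord 0) axis = @fid K 1.
Proof.
apply: funext => j; rewrite /fcomp /fcoord substX /axis //; last exact: centered_axis.
by rewrite /fid ord1.
Qed.

Definition fzero m n : fmap K m n := fun _ => 0.
Arguments fzero : clear implicits.

Lemma subst_fzero m n (f : fps K m) : fps_subst f (fzero m n) = fC (f 0%MM).
Proof.
have z0 : centered (fzero m n) by [].
by rewrite subst_divX // big1 ?addr0 // => i _; rewrite /fzero mul0r.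
Qed.

Lemma fcoord1_axis : fcomp (fcoord 1) axis = fzero 1 1.
Proof.
by apply: funext => j; rewrite /fcomp /fcoord substX //; exact: centered_axis.
Qed.

Lemma mono1E (a : 'X_{1..1}) : a = (U_(0%R) *+ mdeg a)%MM.
Proof.
apply/mnmP => i; rewrite mulmnE mnm1E !ord1 eqxx mul1n mdegE big_ord1.
by [].
Qed.

Lemma coeff_axis (f : fps K 2) l :
  fps_subst f axis (U_(0%R) *+ l)%MM = f (U_(0%R) *+ l)%MM.
Proof.
elim: l f => [|l IH] f.
  by rewrite !mulm0n subst_coef0 //; exact: centered_axis.
rewrite (subst_divX f centered_axis) coeffsD coeffsC mulmS mnmD_eq0 mnm1_eq0.
rewrite mulr0 add0r sum_ord2 coeffsD /axis /= mul0r coeffs0 addr0 coeffsXM.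
rewrite IH /quotX ifT; last by apply/forallP.
by rewrite coeffsB coeffsC mulmS mnmD_eq0 mnm1_eq0 mulr0 subr0.
Qed.

Definition free_of_w (f : fps K 2) : fps K 2 := fun a => if a 1 == 0%N then f a else 0.
Definition quot_w (f : fps K 2) : fps K 2 := fun a => f (U_(1%R) + a)%MM.

(** The restriction to the axis [w = 0] of the partial derivative with respect
    to [w]. *)
Definition dw (f : fps K 2) : fps K 1 := fps_subst (quot_w f) axis.

Lemma split_w f : f = free_of_w f + fX 1 * quot_w f.
Proof.
apply: fpsP => a; rewrite coeffsD /free_of_w; case: eqP => [a1|/eqP a1].
  by rewrite coeffsXM0 // addr0.
have aE : a = (U_(1%R) + (a - U_(1%R)))%MM.
  apply/mnmP => l; rewrite mnmDE mnmBE mnm1E subnKC //.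
  by case: eqP => // <-; rewrite lt0n.
by rewrite aE coeffsXM /quot_w -aE add0r.
Qed.

Lemma subst_free_of_w f : fps_subst (free_of_w f) axis = fps_subst f axis.
Proof.
apply: fpsP => a; rewrite [a]mono1E !coeff_axis /free_of_w.
by rewrite mulmnE mnm1E mul0n.
Qed.

Lemma quot_wD f g : quot_w (f + g) = quot_w f + quot_w g.
Proof. by []. Qed.

Lemma quot_wX f : quot_w (fX 1 * f) = f.
Proof. by apply: fpsP => a; rewrite /quot_w coeffsXM. Qed.

Lemma quot_w_free f g : quot_w (free_of_w f * free_of_w g) = 0.
Proof.
apply: fpsP => a; rewrite /quot_w coeffsM_sum big1 // => k /eqP e.
have := congr1 (fun b : 'X_{1..2} => b 1) e; rewrite !mnmDE mnm1E eqxx add1n.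
rewrite /free_of_w; case: eqP => [->|]; last by rewrite mul0r.
by case: eqP => [->|]; last by rewrite mulr0.
Qed.

Lemma dwM f g : dw (f * g) = dw f * fps_subst g axis + fps_subst f axis * dw g.
Proof.
have cx := centered_axis.
have -> : f * g = free_of_w f * free_of_w g
    + fX 1 * (quot_w f * g + free_of_w f * quot_w g).
  have e (a b c d u v : fps K 2) : u = a + fX 1 * b -> v = c + fX 1 * d ->
    u * v = a * c + fX 1 * (b * v + a * d) by move=> -> ->; ring.
  exact: e (split_w f) (split_w g).
rewrite {1}/dw quot_wD quot_w_free quot_wX add0r substD !(substM cx).
by rewrite subst_free_of_w.
Qed.

Lemma dwD f g : dw (f + g) = dw f + dw g.
Proof. by rewrite /dw quot_wD substD. Qed.

Lemma dwC c : dw (fC c) = 0.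
Proof.
rewrite /dw (_ : quot_w _ = 0) ?subst0 //.
by apply: fpsP => a; rewrite /quot_w coeffsC mnmD_eq0 mnm1_eq0 mulr0.
Qed.

Lemma dw0 : dw 0 = 0. Proof. by have := dwC 0; rewrite !fC0. Qed.
Lemma dw1 : dw 1 = 0. Proof. by have := dwC 1; rewrite fC1. Qed.

Lemma dwX f k : dw (f ^+ k.+1) = (fps_subst f axis ^+ k * dw f) *+ k.+1.
Proof.
have cx := centered_axis.
elim: k => [|k IH]; first by rewrite expr1 expr0 mul1r.
by rewrite exprS dwM IH substXn // !mulrSr !exprS; ring.
Qed.

Lemma dw_prod0 I (r : seq I) (F : I -> fps K 2) :
  (forall i, dw (F i) = 0) -> dw (\prod_(i <- r) F i) = 0.
Proof.
move=> h; elim: r => [|i r IH]; rewrite ?big_nil ?big_cons.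
  exact: dw1.
by rewrite dwM h IH mul0r mulr0 addr0.
Qed.

Lemma dw_feq d f g : feq d.+1 f g -> feq d (dw f) (dw g).
Proof.
move=> /feqP h; apply: feq_substl; first exact: centered_axis.
by apply/feqP => a ha; apply: h; rewrite mdegD mdeg1.
Qed.

Lemma feq_trunc n d (f : fps K n) : feq d.+1 f (fps_of_mpoly (trunc d f)).
Proof. by apply/feqP => a ha; rewrite /fps_of_mpoly mcoeff_trunc. Qed.

(** The chain rule when the inner derivatives vanish; it follows from Leibniz's
    rule for polynomials [f], and [dw] is continuous. *)
Lemma dw_subst0 m (f : fps K m) (G : fmap K m 2) : centered G ->
  (forall i, dw (G i) = 0) -> dw (fps_subst f G) = 0.
Proof.
move=> G0 hG; apply: fpsP => a; set d := mdeg a.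
have h : feq d.+1 (dw (fps_subst f G)) (dw (fps_subst (fps_of_mpoly (trunc d.+1 f)) G)).
  by apply/dw_feq/feq_substl/feq_trunc.
rewrite (proj1 (feqP _ _ _) h) // subst_poly //.
rewrite (_ : dw _ = 0) //; elim/big_rec: _ => [|b x _ IH].
  exact: dw0.
rewrite dwD IH addr0 dwM dwC mul0r add0r dw_prod0 ?mulr0 // => i.
by case: (b i) => [|k]; rewrite ?expr0 ?dw1 // dwX hG mulr0 mul0rn.
Qed.

Lemma fps1_unit_part (f : fps K 1) : f <> 0 ->
  exists k (u : fps K 1), f = fX 0 ^+ k * u /\ u 0%MM != 0.
Proof.
move=> f0; have [l fl] : exists l, f (U_(0%R) *+ l)%MM != 0.
  apply: contrapT => h; apply: f0; apply: fpsP => a; rewrite [a]mono1E.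
  by apply/eqP/negPn/negP => ne; apply: h; exists (mdeg a).
elim: l f fl {f0} => [|l IH] f fl.
  by exists 0%N, f; rewrite expr0 mul1r; split.
have [f0|f0] := eqVneq (f 0%MM) 0; last by exists 0%N, f; rewrite expr0 mul1r; split.
have fE : f = fX 0 * quotX 0 f by rewrite {1}[f]divX // big_ord1.
have [|k [u [h1 h2]]] := IH (quotX 0 f).
  by rewrite /quotX ifT ?mulmS // in fl *; apply/forallP.
by exists k.+1, u; split=> //; rewrite fE h1 exprS mulrA.
Qed.

Lemma fps1_regular (f g : fps K 1) : f <> 0 -> f * g = 0 -> g = 0.
Proof.
move=> /fps1_unit_part[k [u [-> u0]]]; have [v uv] := fps_unit u0.
move=> h; have {h} : fX 0 ^+ k * g = 0.
  have -> : fX 0 ^+ k * g = fX 0 ^+ k * g * (u * v) by rewrite uv mulr1.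
  have -> : fX 0 ^+ k * g * (u * v) = fX 0 ^+ k * u * g * v by ring.
  by rewrite h mul0r.
elim: k => [|k IH]; first by rewrite expr0 mul1r.
rewrite exprS -mulrA => h; apply: IH; apply: (@fX_inj _ _ 0).
by rewrite h mulr0.
Qed.

End Plane.
Arguments fzero : clear implicits.

Section CharacteristicZero.
Variable K : numFieldType.

(** By the chain rule the derivative of [s o psi] along [w] on the axis is
    [s'(psi(z, 0)) psi_w(z, 0)], a product of nonzero series. The proof factors
    [s] as a power of the variable times a unit, for which Leibniz's rule is
    enough. *)
Lemma dw_subst_neq0 (s : fps K 1) (psi : fps K 2) : s 0%MM = 0 -> s <> 0 ->
  psi 0%MM = 0 -> psi U_(1%R)%MM != 0 -> fps_subst psi (axis K) <> 0 ->
  dw (fps_subst s (fun _ => psi)) <> 0.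
Proof.
move=> s0 sn0 psi0 psi1 y0 h.
pose P : fmap K 1 2 := fun _ => psi; have P0 : centered P by [].
have cx := centered_axis K.
have [[|k] [u [sE u0]]] := fps1_unit_part sn0.
  by move: u0; rewrite -[u]mul1r -(expr0 (fX 0)) -sE s0 eqxx.
move: h; rewrite sE -/P (substM P0) (substXn P0) (substX P0) dwM dwX.
rewrite -[P 0]/psi (substXn cx); move: y0 psi1.
set y := fps_subst psi _; set v := fps_subst u P => y0 psi1.
have factor (p q b c : fps K 1) n : (p * q) *+ n * b + y * p * c =
    p * ((q * b) *+ n + y * c).
  by rewrite mulrDr mulrnAl mulrnAr mulrA [p * (y * c)]mulrCA mulrA.
rewrite exprS factor.
have reg i (f : fps K 1) : y ^+ i * f = 0 -> f = 0.
  elim: i => [|i IH]; first by rewrite expr0 mul1r.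
  by rewrite exprS -mulrA => /(fps1_regular y0).
move=> /reg /(congr1 (fun f : fps K 1 => f 0%MM)).
have y00 : y 0%MM = 0 by rewrite /y (subst_coef0 _ cx).
have v00 : fps_subst v (axis K) 0%MM = u 0%MM.
  by rewrite (subst_coef0 _ cx) /v (subst_coef0 _ P0).
rewrite coeffsD [(y * _) _]coeffs0M y00 mul0r addr0.
rewrite -mulr_natl; have -> : k.+1%:R = fC k.+1%:R :> fps K 1.
  by rewrite /fC !rmorph_nat.
rewrite coeffsCM coeffs0M v00 /dw (subst_coef0 _ cx) /quot_w addm0.
by move=> /eqP; rewrite !mulf_eq0 pnatr_eq0 (negPf psi1) (negPf u0).
Qed.

End CharacteristicZero.

(** * Products of curves and singular branches *)

Section Pairs.
Variable K : fieldType.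

Definition pair_map n (S T : fmap K 2 n) : fmap K 4 n := fun k =>
  match split (k : 'I_(2 + 2)) with inl j => S j | inr j => T j end.

Definition fst_map n (S : fmap K 4 n) : fmap K 2 n := fun j => S (lshift 2 j).
Definition snd_map n (S : fmap K 4 n) : fmap K 2 n := fun j => S (rshift 2 j).

Lemma fst_pair n (S T : fmap K 2 n) : fst_map (pair_map S T) = S.
Proof. by apply: funext => j; rewrite /fst_map /pair_map (unsplitK (inl _ j)). Qed.

Lemma snd_pair n (S T : fmap K 2 n) : snd_map (pair_map S T) = T.
Proof. by apply: funext => j; rewrite /snd_map /pair_map (unsplitK (inr _ j)). Qed.

Lemma pair_mapE n (S : fmap K 4 n) : S = pair_map (fst_map S) (snd_map S).
Proof.
apply: funext => k; rewrite /pair_map /fst_map /snd_map.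
by rewrite -{1}[k](@splitK 2 2); case: (split _).
Qed.

Lemma fcomp_pair m n (S T : fmap K 2 m) (G : fmap K m n) :
  fcomp (pair_map S T) G = pair_map (fcomp S G) (fcomp T G).
Proof. by apply: funext => k; rewrite /fcomp /pair_map; case: (split _). Qed.

Lemma centered_pair n (S T : fmap K 2 n) :
  centered S -> centered T -> centered (pair_map S T).
Proof. by move=> S0 T0 k; rewrite /pair_map; case: (split _). Qed.

Lemma jacobian_pair n (S T : fmap K 2 n) :
  jacobian (pair_map S T) = col_mx (jacobian S) (jacobian T) :> 'M_(2 + 2, n).
Proof.
apply/matrixP => l j; rewrite -[l](@splitK 2 2).
case: (split _) => k /=; rewrite ?col_mxEu ?col_mxEd !mxE.
  by rewrite -[in RHS](fst_pair S T).
by rewrite -[in RHS](snd_pair S T).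
Qed.

Definition prod_map (s t : fmap K 2 1) : fmap K 4 2 :=
  pair_map (fcomp s (fcoord K 0)) (fcomp t (fcoord K 1)).

Lemma centered_prod s t : centered s -> centered t -> centered (prod_map s t).
Proof. by move=> s0 t0; apply: centered_pair; apply: centered_comp. Qed.

Lemma jacobian_prod s t : jacobian (prod_map s t) =
  col_mx (jacobian s *m jacobian (fcoord K 0)) (jacobian t *m jacobian (fcoord K 1))
  :> 'M_(2 + 2, 2).
Proof.
rewrite /prod_map jacobian_pair (jacobian_comp s (centered_fcoord _ 0)).
by rewrite (jacobian_comp t (centered_fcoord _ 1)).
Qed.

Lemma jacobian_prod0 s t : jacobian s = 0 -> jacobian t = 0 ->
  jacobian (prod_map s t) = 0.
Proof. by move=> hs ht; rewrite jacobian_prod hs ht !mul0mx col_mx0. Qed.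

Lemma jacobian_prod_eq0 s t : jacobian (prod_map s t) = 0 -> jacobian s = 0.
Proof.
rewrite jacobian_prod => h.
have {h} : jacobian s *m jacobian (fcoord K 0) = 0 :> 'M_(2, 2).
  have := congr1 (fun M : 'M[K]_(2 + 2, 2) => usubmx M) h; rewrite /= col_mxKu => e.
  by apply: (etrans e); apply/matrixP => l j; rewrite !mxE.
move=> /(congr1 (mulmx^~ (jacobian (axis K)))).
rewrite mul0mx -mulmxA -(jacobian_comp (fcoord K 0) (@centered_axis K)) fcoord_axis.
by rewrite jacobian_id mulmx1.
Qed.

Lemma fcomp_fzero l m n (S : fmap K l m) : centered S ->
  fcomp S (fzero K m n) = fzero K l n.
Proof. by move=> S0; apply: funext => i; rewrite /fcomp subst_fzero S0 fC0. Qed.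

Lemma prod_comp n s t (G : fmap K 2 n) : centered G ->
  fcomp (prod_map s t) G = pair_map (fcomp s (fun _ => G 0)) (fcomp t (fun _ => G 1)).
Proof.
move=> G0; rewrite /prod_map fcomp_pair.
have e i : fcomp (fcoord K i) G = fun _ => G i.
  by apply: funext => j; rewrite /fcomp /fcoord substX.
by rewrite !(fcompA _ (centered_fcoord _ _) G0) !e.
Qed.

Lemma prod_axis s t : centered t ->
  fcomp (prod_map s t) (axis K) = pair_map s (fzero K 2 1).
Proof.
move=> t0; rewrite (prod_comp _ _ (@centered_axis K)); congr pair_map.
  rewrite -[RHS]fcomp_id_r; congr fcomp; apply: funext => j.
  by rewrite ord1.
exact: fcomp_fzero.
Qed.

End Pairs.

Section Singular.
Variable K : numFieldType.

Lemma jacobian_col0 m n (s : fmap K m n) (i : 'I_m) j :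
  jacobian s = 0 -> s i U_(j)%MM = 0.
Proof. by move=> /matrixP/(_ i j); rewrite !mxE. Qed.

(** As [t] is singular, all functions of [(s(z), t(w))] have vanishing
    derivative with respect to [w] along [w = 0]. For [s'(Psi 0)] and [t'(Psi 1)]
    this means that either [Psi 0] or [Psi 1] vanishes on the axis, as their
    [w]-derivatives at the origin are not both zero. *)
Lemma diffeo_preserves_axes (Phi : fmap K 4 4) (s t s' t' : fmap K 2 1)
    (Psi : fmap K 2 2) :
  formal_diffeo Psi -> centered s -> centered t -> jacobian t = 0 ->
  param_curve s' -> param_curve t' ->
  fcomp Phi (prod_map s t) = fcomp (prod_map s' t') Psi ->
  fps_subst (Psi 0) (axis K) = 0 \/ fps_subst (Psi 1) (axis K) = 0.
Proof.
move=> [Psi0 JPsi] s0 t0 Jt [s0' sn] [t0' tn] E.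
have cx := centered_axis K.
have P0 := centered_prod s0 t0.
have dwP k : dw (prod_map s t k) = 0.
  rewrite /prod_map /pair_map; case: (split _) => j; rewrite /fcomp.
    apply: dw_subst0 => [|i]; first exact: centered_fcoord.
    by rewrite /dw (_ : quot_w _ = 0) ?subst0 //; apply: fpsP => a;
       rewrite /quot_w /fcoord coeffsX; case: eqP => // /(congr1 (fun b : 'X_{1..2} => b 1));
       rewrite mnmDE !mnm1E.
  rewrite [t j]divX // big_ord1 (substM (centered_fcoord _ _)).
  rewrite substX; last exact: centered_fcoord.
  rewrite /fcoord dwM substX // /axis /= mul0r addr0 substA //; last exact: centered_fcoord.
  rewrite -/(axis K) (_ : fcomp _ _ = fzero K 1 1); last exact: fcoord1_axis.
  by rewrite subst_fzero quotX0 (jacobian_col0 _ _ Jt) fC0 mulr0.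
have dwE k : dw (fcomp (prod_map s' t') Psi k) = 0.
  by rewrite -E; apply: dw_subst0.
have nz (u : fmap K 2 1) : ~ (u =2 fun _ _ => 0) -> exists j, u j <> 0.
  move=> un; apply: contrapT => h; apply: un => j a.
  by have -> : u j = 0 by apply: contrapT => hj; apply: h; exists j.
have [j sj] := nz _ sn; have [l tl] := nz _ tn.
case: (pselect (fps_subst (Psi 0) (axis K) = 0)) => [|n0]; first by left.
case: (pselect (fps_subst (Psi 1) (axis K) = 0)) => [|n1]; first by right.
exfalso; rewrite (prod_comp _ _ Psi0) in dwE.
have c0 : Psi 0 U_(1%R)%MM = 0.
  apply/eqP/negPn/negP => h; apply: (dw_subst_neq0 (s0' j) sj (Psi0 0) h n0).
  by have := dwE (lshift 2 j); rewrite /pair_map (unsplitK (inl _ j)).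
have c1 : Psi 1 U_(1%R)%MM = 0.
  apply/eqP/negPn/negP => h; apply: (dw_subst_neq0 (t0' l) tl (Psi0 1) h n1).
  by have := dwE (rshift 2 l); rewrite /pair_map (unsplitK (inr _ l)).
move: JPsi; rewrite unitmxE det_mx2 !mxE c0 c1 mulr0 mul0r subrr.
by rewrite unitr0.
Qed.

(** Otherwise [H = 0] would be a smooth curve containing [s]. Straightening it
    to the axis shows that [s] is obtained from a parametrization of this curve
    by a substitution of order at least two, because [s] is singular. *)
Lemma irreducible_singular_in_smooth (H : fps K 2) (s : fmap K 2 1) :
  irreducible_param s -> jacobian s = 0 -> H 0%MM = 0 -> fps_subst H s = 0 ->
  forall i, H U_(i)%MM = 0.
Proof.
move=> [[s0 sn] irr] Js H0 Hs i; apply/eqP/negPn/negP => hi.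
pose o : 'I_2 := if i == 0 then 1 else 0.
pose G : fmap K 2 2 := fun k => if k == 0 then fX o else H.
have dG : formal_diffeo G.
  split; first by move=> k; rewrite /G; case: ifP => // _; rewrite coeffsX mnm1_eq0.
  rewrite unitmxE det_mx2 !mxE /G /= !coeffsX unitfE /o.
  have i01 : i = 0 \/ i = 1.
    by case: (i) => -[|[|//]] h; [left|right]; apply: val_inj.
  have ne : (U_(0%R) == U_(1%R) :> 'X_{1..2})%MM = false.
    by apply/negP => /eqP/mnmP/(_ 0); rewrite !mnm1E.
  have ne' : (U_(1%R) == U_(0%R) :> 'X_{1..2})%MM = false by rewrite eq_sym.
  by case: i01 hi => -> hi; rewrite /= ?eqxx ?ne ?ne' ?mulr1n ?mulr0n ?mul0r ?mul1r
     ?subr0 ?sub0r ?oppr_eq0.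
have [F [dF GF FG]] := formal_diffeo_inverse dG.
have cx := centered_axis K.
apply: irr; exists (fcomp F (axis K)), (fun _ => s o); split.
- split; first exact: centered_comp dF.1.
  move=> /fmapP h; have := congr1 (fcomp G) h.
  rewrite -(fcompA _ dF.1 cx) GF (fcomp_id_l cx) => /(congr1 (fun T => T 0 U_(0%R)%MM)).
  rewrite /axis /= -/(fzero K 2 1) fcomp_fzero; last exact: dG.1.
  by rewrite coeffsX eqxx => /eqP; rewrite oner_eq0.
- move=> _ m; rewrite leq_eqVlt ltnS leqn0 => /orP[/mdeg1P[j /eqP ->]|].
    exact: jacobian_col0.
  by rewrite mdeg_eq0 => /eqP ->.
have u0 : centered (fun _ : 'I_1 => s o) by [].
have Gs : fcomp G s = fcomp (axis K) (fun _ => s o).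
  apply: fmap2P; rewrite /fcomp /G /axis /=; first by rewrite !substX.
  by rewrite Hs subst0.
suff sE : s = fcomp (fcomp F (axis K)) (fun _ => s o).
  by move=> k m; exact: (congr1 (fun T => T k m) sE).
by rewrite (fcompA _ cx u0) -Gs -(fcompA _ dG.1 s0) FG fcomp_id_l.
Qed.

(** A reparametrization of order at least two would contradict the
    irreducibility of [s = F^-1 o t o phi]. *)
Lemma irreducible_reparam (F : fmap K 2 2) (s t : fmap K 2 1) (phi : fmap K 1 1) :
  formal_diffeo F -> irreducible_param s -> centered t -> centered phi ->
  fcomp F s = fcomp t phi -> formal_diffeo phi.
Proof.
move=> dF [[s0 sn] irr] t0 phi0 E; split=> //.
rewrite unitmxE det_mx11 unitfE mxE; apply/negP => /eqP p1; apply: irr.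
have [G [dG _ GF]] := formal_diffeo_inverse dF.
have sE : s = fcomp (fcomp G t) phi.
  by rewrite (fcompA _ t0 phi0) -E -(fcompA _ dF.1 s0) GF fcomp_id_l.
exists (fcomp G t), phi; split; last by rewrite -sE.
  split; first exact: centered_comp dG.1.
  move=> /fmapP h; apply: sn; rewrite sE h => i a.
  by rewrite /fcomp subst0.
move=> i m; rewrite !ord1 leq_eqVlt ltnS leqn0 => /orP[/mdeg1P[j /eqP ->]|].
  by rewrite ord1.
by rewrite mdeg_eq0 => /eqP ->.
Qed.

Definition incl1 : fmap K 4 2 := pair_map (@fid K 2) (fzero K 2 2).

Lemma centered_incl1 : centered incl1.
Proof. by apply: centered_pair => //; apply: centered_id. Qed.

(** [F] is one of the two halves of [Phi(., 0)]: the half that is constant along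
    the singular branch [C i0] has zero linear part, so that the other one has
    an invertible linear part. *)
Lemma singular_component r (C C' D D' : 'I_r -> fmap K 2 1) (Phi : fmap K 4 4)
    (Psi : 'I_r -> fmap K 2 2) i0 :
  formal_diffeo Phi -> (forall i, formal_diffeo (Psi i)) ->
  (forall i, irreducible_param (C i)) -> (forall i, centered (D i)) ->
  (forall i, param_curve (C' i)) -> (forall i, param_curve (D' i)) ->
  (forall i, fcomp Phi (prod_map (C i) (D i)) =
             fcomp (prod_map (C' i) (D' i)) (Psi i)) ->
  jacobian (C i0) = 0 -> jacobian (D i0) = 0 ->
  exists F : fmap K 2 2, formal_diffeo F /\ exists phi : 'I_r -> fmap K 1 1,
    (forall i, formal_diffeo (phi i)) /\
    ((forall i, fcomp F (C i) = fcomp (C' i) (phi i)) \/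
     (forall i, fcomp F (C i) = fcomp (D' i) (phi i))).
Proof.
move=> dPhi dPsi irrC D0 cC' cD' E JC JD.
have C0 i : centered (C i) by have [[]] := irrC i.
have cx := centered_axis K; have i10 := centered_incl1.
pose T := fcomp Phi incl1; have T0 : centered T := centered_comp _ dPhi.1.
pose F1 := fst_map T; pose F2 := snd_map T.
have F10 : centered F1 by move=> j; apply: T0.
have F20 : centered F2 by move=> j; apply: T0.
pose phi k i : fmap K 1 1 := fun _ => fps_subst (Psi i k) (axis K).
have phi0 k i : centered (phi k i).
  by move=> j; rewrite /phi (subst_coef0 _ cx) (dPsi i).1.
have key i : pair_map (fcomp F1 (C i)) (fcomp F2 (C i)) =
    pair_map (fcomp (C' i) (phi 0 i)) (fcomp (D' i) (phi 1 i)).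
  rewrite -fcomp_pair -pair_mapE (fcompA _ i10 (C0 i)).
  have -> : fcomp incl1 (C i) = fcomp (prod_map (C i) (D i)) (axis K).
    rewrite prod_axis // fcomp_pair (fcomp_id_l (C0 i)); congr pair_map.
    by apply: funext => j; rewrite /fcomp subst0.
  rewrite -(fcompA _ (centered_prod (C0 i) (D0 i)) cx) E.
  rewrite (fcompA _ (dPsi i).1 cx) prod_comp //; exact: centered_comp (dPsi i).1.
have key1 i : fcomp F1 (C i) = fcomp (C' i) (phi 0 i).
  by have := congr1 (@fst_map _ _) (key i); rewrite !fst_pair.
have key2 i : fcomp F2 (C i) = fcomp (D' i) (phi 1 i).
  by have := congr1 (@snd_map _ _) (key i); rewrite !snd_pair.
have JT : jacobian T = jacobian (pair_map F1 F2) by rewrite -pair_mapE.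
have flat (F : fmap K 2 2) (S : fmap K 2 1) : centered F -> centered S ->
    fcomp F (C i0) = fcomp S (fun _ => 0) -> jacobian F = 0.
  move=> F0 S0 h; apply/matrixP => k j; rewrite !mxE.
  apply: irreducible_singular_in_smooth (irrC i0) JC (F0 k) _ _.
  rewrite -/(fcomp F (C i0) k) h -/(fzero K 1 1) fcomp_fzero //.
have JI1 : jacobian incl1 = col_mx (1%:M : 'M_2) (0 : 'M_2) :> 'M_(2 + 2, 2).
  rewrite /incl1 jacobian_pair jacobian_id; congr col_mx.
  by apply/matrixP => l j; rewrite !mxE.
case: (diffeo_preserves_axes (dPsi i0) (C0 i0) (D0 i0) JD (cC' i0) (cD' i0) (E i0)) => ax.
- have JF1 : jacobian F1 = 0.
    apply: (flat _ _ F10 (cC' i0).1).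
    by rewrite key1 /phi ax.
  have JF2 : jacobian F2 \in unitmx.
    have [_ JPhi] := dPhi.
    have e : jacobian Phi *m jacobian incl1 = col_mx 0 (jacobian F2) :> 'M_(2 + 2, 2).
      by rewrite -jacobian_comp // -/T JT jacobian_pair JF1.
    have : (row_mx 1%:M 0 : 'M_(2, 2 + 2)) *m (invmx (jacobian Phi) : 'M_(2 + 2, 2 + 2)) *m
       (col_mx 0 1%:M) *m jacobian F2 = 1%:M :> 'M_2.
      rewrite -mulmxA mul_col_mx mul0mx mul1mx -e -mulmxA mulKmx // JI1.
      by rewrite mul_row_col mul1mx mul0mx addr0.
    by move=> /mulmx1_unit[].
  have dF2 : formal_diffeo F2 by split.
exists F2; split=> //.
  exists (phi 1); split; last by right; exact: key2.
  by move=> i; exact: (irreducible_reparam dF2 (irrC i) (cD' i).1 (phi0 1 i) (key2 i)).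
have JF2 : jacobian F2 = 0.
  apply: (flat _ _ F20 (cD' i0).1).
  by rewrite key2 /phi ax.
have JF1 : jacobian F1 \in unitmx.
  have [_ JPhi] := dPhi.
  have e : jacobian Phi *m jacobian incl1 = col_mx (jacobian F1) 0 :> 'M_(2 + 2, 2).
    by rewrite -jacobian_comp // -/T JT jacobian_pair JF2.
  have : (row_mx 1%:M 0 : 'M_(2, 2 + 2)) *m (invmx (jacobian Phi) : 'M_(2 + 2, 2 + 2)) *m
     (col_mx 1%:M 0) *m jacobian F1 = 1%:M :> 'M_2.
    rewrite -mulmxA mul_col_mx mul0mx mul1mx -e -mulmxA mulKmx // JI1.
    by rewrite mul_row_col mul1mx mul0mx addr0.
  by move=> /mulmx1_unit[].
have dF1 : formal_diffeo F1 by split.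
exists F1; split=> //.
exists (phi 0); split; last by left; exact: key1.
by move=> i; exact: (irreducible_reparam dF1 (irrC i) (cC' i).1 (phi0 0 i) (key1 i)).
Qed.

End Singular.

(** * Smooth branches *)

Section Contact.
Variable K : fieldType.

Definition contact d m n (s t : fmap K m n) : Prop :=
  exists theta : fmap K n n, centered theta /\
    forall i, feq d (s i) (fps_subst (t i) theta).

Lemma contact_transport d l m n (F : fmap K l m) (s t : fmap K m n)
    (s' t' : fmap K l n) (phi chi : fmap K n n) :
  centered s -> centered t -> formal_diffeo phi -> centered chi ->
  fcomp F s = fcomp s' phi -> fcomp F t = fcomp t' chi ->
  contact d s t -> contact d s' t'.
Proof.
move=> s0 t0 dphi chi0 Es Et [theta [th0 h]].
have [psi [dpsi phipsi _]] := formal_diffeo_inverse dphi.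
have psi0 := dpsi.1; have thpsi0 := centered_comp psi th0.
exists (fcomp chi (fcomp theta psi)); split; first exact: centered_comp.
have s'E : s' = fcomp F (fcomp s psi).
  by rewrite -(fcompA _ s0 psi0) Es (fcompA _ dphi.1 psi0) phipsi fcomp_id_r.
have tE : fcomp t' (fcomp chi (fcomp theta psi)) =
    fcomp F (fcomp (fcomp t theta) psi).
  rewrite -(fcompA _ chi0 thpsi0) -Et (fcompA _ t0 thpsi0).
  exact/(congr1 (fcomp F))/esym/(fcompA t th0 psi0).
move=> i; change (feq d (s' i) (fcomp t' (fcomp chi (fcomp theta psi)) i)).
rewrite tE s'E; apply: feq_subst.
- exact: centered_comp.
- by apply/centered_comp/centered_comp.
by move=> j; apply: feq_substl.
Qed.

Lemma contact_fst d (s t s2 t2 : fmap K 2 1) :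
  centered s2 -> centered t2 ->
  contact d (prod_map s s2) (prod_map t t2) -> contact d s t.
Proof.
move=> s20 t20 [theta [th0 h]]; have cx := centered_axis K.
have tx0 : centered (fcomp theta (axis K)) by apply: centered_comp.
exists (fun _ => fcomp theta (axis K) 0); split=> [i|j]; first exact: tx0.
have e1 : s j = fps_subst (prod_map s s2 (lshift 2 j)) (axis K).
  rewrite -/(fcomp (prod_map s s2) (axis K) _) prod_axis //.
  by rewrite -/(fst_map _ j) fst_pair.
have e2 : fps_subst (t j) (fun _ => fcomp theta (axis K) 0) =
    fps_subst (fps_subst (prod_map t t2 (lshift 2 j)) theta) (axis K).
  rewrite (substA _ th0 cx).
  rewrite -[RHS]/(fst_map (fcomp (prod_map t t2) (fcomp theta (axis K))) j).
  by rewrite (prod_comp _ _ tx0) fst_pair.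
by rewrite e1 e2; apply: feq_substl.
Qed.

Lemma contact_prod d (s t s2 t2 : fmap K 2 1) :
  contact d s t -> contact d s2 t2 -> contact d (prod_map s s2) (prod_map t t2).
Proof.
move=> [th [th0 h]] [th2 [th20 h2]].
have c0 := @centered_fcoord K 2.
pose theta : fmap K 2 2 := fun i => if i == 0 then fps_subst (th 0) (fcoord K 0)
  else fps_subst (th2 0) (fcoord K 1).
have theta0 : centered theta.
  by move=> i; rewrite /theta; case: ifP => _; rewrite subst_coef0.
exists theta; split=> // k.
rewrite -/(fcomp (prod_map t t2) theta k) prod_comp //.
have thE (u : fmap K 1 1) : u = fun _ => u 0 by apply: funext => i; rewrite ord1.
rewrite /prod_map /pair_map; case: (split _) => j; rewrite /fcomp.
  rewrite (_ : (fun _ => theta 0) = fcomp th (fcoord K 0)); last first.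
    by rewrite [in RHS](thE th).
  by rewrite -substA //; apply: feq_substl.
rewrite (_ : (fun _ => theta 1) = fcomp th2 (fcoord K 1)); last first.
  by rewrite [in RHS](thE th2).
by rewrite -substA //; apply: feq_substl.
Qed.

Lemma contact_map (theta : {rmorphism K -> K}) d m n (s t : fmap K m n) :
  contact d s t -> contact d (fmap_map theta s) (fmap_map theta t).
Proof.
move=> [th [th0 h]]; exists (fmap_map theta th); split; first exact: centered_map.
move=> i; apply/feqP => a ha; rewrite /fmap_map -fps_map_subst /fps_map.
by rewrite (proj1 (feqP _ _ _) (h i) a ha).
Qed.

(** The first coordinate forces the reparametrization to be the identity up to
    order [d]. *)
Lemma contact_graph d (f g : fps K 1) : f 0%MM = 0 -> g 0%MM = 0 ->
  contact d (graph f) (graph g) <-> feq d f g.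
Proof.
move=> f0 g0; split=> [[th [th0 h]]|h]; last first.
  exists (@fid K 1); split; first exact: centered_id.
  move=> i; rewrite fps_comp_id /graph; case: ifP => // _; exact: feq_refl.
have h0 := h 0; have h1 := h 1; rewrite /graph /= in h0 h1.
rewrite (substX th0) in h0; apply: feq_trans h1 _.
rewrite -[X in feq _ _ X]fps_comp_id; apply: feq_subst => //.
  exact: centered_id.
by move=> i; rewrite ord1; apply: feq_sym; exact: h0.
Qed.

Lemma slope_coef l (g : fps K 1) : slope l g = g (U_(0%R) *+ l.+1)%MM.
Proof.
have it k : iter l (@blow_graph K) g (U_(0%R) *+ k.+1)%MM = g (U_(0%R) *+ (l + k).+1)%MM.
  elim: l k => //= l IH k; rewrite {1}/blow_graph coeffsB coeffsC.
  rewrite mulmS mnmD_eq0 mnm1_eq0 mulr0 subr0 -mulmS.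
  rewrite /quotX ifT; last by apply/forallP.
  by rewrite -mulmS IH addSnnS.
by rewrite /slope -[U_(0%R)%MM]mulm1n it addn0.
Qed.

Lemma graph_path_feq (f g : fps K 1) n : f 0%MM = 0 -> g 0%MM = 0 ->
  graph_path f n = graph_path g n <-> feq n.+1 f g.
Proof.
move=> f0 g0; split=> [h|/feqP h].
  apply/feqP => a ha; rewrite [a]mono1E; case: (mdeg a) ha => [|l] ha.
    by rewrite mulm0n f0 g0.
  have := congr1 (fun p => nth None p l) h; rewrite !nth_mkseq // => -[].
  by rewrite !slope_coef.
apply/eq_in_map => l; rewrite mem_iota add0n => /andP[_ ln].
by rewrite !slope_coef h // mdegMn mdeg1 mul1n.
Qed.

End Contact.

Section SmoothBranches.
Variable K : numFieldType.

(** Among the integers [0], ..., [r] one is not a quotient [- a i / b i]. *)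
Lemma avoid_finite r (a b : 'I_r -> K) :
  (forall i, (a i != 0) || (b i != 0)) -> exists c, forall i, a i + c * b i != 0.
Proof.
move=> h; pose s := [seq - a i / b i | i : 'I_r].
have [x xs] : exists n : nat, n%:R \notin s.
  apply: contrapT => hs.
  have sub : {subset [seq n%:R | n <- iota 0 (size s).+1] <= s}.
    move=> x /mapP[n _ ->]; apply/negPn/negP => hn; apply: hs; by exists n.
    have un : uniq [seq (n%:R : K) | n <- iota 0 (size s).+1].
    rewrite map_inj_uniq ?iota_uniq // => m n /eqP; rewrite eqr_nat => /eqP.
    exact.
  by have := uniq_leq_size un sub; rewrite size_map size_iota ltnn.
exists x%:R => i; have [b0|b0] := eqVneq (b i) 0.
  by have := h i; rewrite b0 eqxx orbF mulr0 addr0.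
apply: contra xs => /eqP e; apply/mapP; exists i; first by rewrite mem_enum.
by apply: (mulIf b0); rewrite divfK // -[RHS]add0r -e [a i + _]addrC addrK.
Qed.

(** A suitable linear change of coordinates makes no branch vertical; the first
    coordinate is then a parameter on each branch. *)
Lemma smooth_branches_graphs r (C : 'I_r -> fmap K 2 1) :
  (forall i, centered (C i)) -> (forall i, jacobian (C i) != 0) ->
  exists (F : fmap K 2 2) (g : 'I_r -> fps K 1) (phi : 'I_r -> fmap K 1 1),
    [/\ formal_diffeo F, forall i, g i 0%MM = 0, forall i, formal_diffeo (phi i)
      & forall i, fcomp F (C i) = fcomp (graph (g i)) (phi i)].
Proof.
move=> C0 JC; have [|c hc] := @avoid_finite r (fun i => C i 0 U_(0%R)%MM)
  (fun i => C i 1 U_(0%R)%MM).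
  move=> i; rewrite -negb_and; apply: contra (JC i) => /andP[/eqP h0 /eqP h1].
  apply/eqP/matrixP => k j; rewrite !mxE ord1; move: k => -[[|[|//]] hk].
    by rewrite (_ : Ordinal hk = 0) //; apply: val_inj.
  by rewrite (_ : Ordinal hk = 1) //; apply: val_inj.
pose M : 'M[K]_2 := \matrix_(i, j) if i == 0 then (if j == 0 then 1 else c) else (j == 1)%:R.
have dF : formal_diffeo (linmap M).
  by apply: diffeo_linmap; rewrite unitmxE det_mx2 !mxE /= mulr0 subr0 mulr1 unitr1.
pose phi i : fmap K 1 1 := fun _ => fcomp (linmap M) (C i) 0.
have dphi i : formal_diffeo (phi i).
  split; first by move=> j; apply: centered_comp dF.1 _.
  rewrite unitmxE det_mx11 unitfE mxE /phi.
  rewrite (_ : fcomp _ _ _ _ = jacobian (fcomp (linmap M) (C i)) 0 0); last by rewrite mxE.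
  by rewrite jacobian_comp // jacobian_linmap !mxE sum_ord2 !mxE /= mul1r.
have [psi hpsi] := choice (fun i => formal_diffeo_inverse (dphi i)).
have dpsi i : formal_diffeo (psi i) by have [] := hpsi i.
have psiphi i : fcomp (psi i) (phi i) = @fid K 1 by have [] := hpsi i.
exists (linmap M), (fun i => fps_subst (fcomp (linmap M) (C i) 1) (psi i)), phi.
split=> // i; first by rewrite (subst_coef0 _ (dpsi i).1) (centered_comp _ dF.1).
apply: fmap2P; rewrite [RHS]/fcomp /graph /=; first by rewrite (substX (dphi i).1).
by rewrite (substA _ (dpsi i).1 (dphi i).1) psiphi fps_comp_id.
Qed.

Lemma smooth_tree_iso r (C C' : 'I_r -> fmap K 2 1) :
  (forall i, centered (C i)) -> (forall i, centered (C' i)) ->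
  (forall i, jacobian (C i) != 0) -> (forall i, jacobian (C' i) != 0) ->
  (forall i j d, contact d (C i) (C j) <-> contact d (C' i) (C' j)) ->
  tree_iso C C' id.
Proof.
move=> C0 C0' JC JC' hc.
have [F [g [phi [dF g0 dphi E]]]] := smooth_branches_graphs C0 JC.
have [F' [g' [phi' [dF' g0' dphi' E']]]] := smooth_branches_graphs C0' JC'.
have G0 i : centered (graph (g i)) by apply: centered_graph.
have G0' i : centered (graph (g' i)) by apply: centered_graph.
have contE (D : 'I_r -> fmap K 2 1) H h ph : (forall i, centered (D i)) ->
    formal_diffeo H -> (forall i, h i 0%MM = 0) -> (forall i, formal_diffeo (ph i)) ->
    (forall i, fcomp H (D i) = fcomp (graph (h i)) (ph i)) ->
    forall i j d, contact d (D i) (D j) <-> feq d (h i) (h j).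
  move=> D0 dH h0 dph EH i j d; rewrite -(contact_graph d (h0 i) (h0 j)).
  have gh0 k : centered (graph (h k)) by apply: centered_graph.
  split; first exact: (contact_transport (D0 i) (D0 j) (dph i) (dph j).1 (EH i) (EH j)).
  have [H' [dH' HH' H'H]] := formal_diffeo_inverse dH.
  have inv k : exists2 q, formal_diffeo q & fcomp H' (graph (h k)) = fcomp (D k) q.
    have [q [dq pq _]] := formal_diffeo_inverse (dph k); exists q => //.
    have -> : graph (h k) = fcomp (fcomp H (D k)) q.
      by rewrite EH (fcompA _ (dph k).1 dq.1) pq fcomp_id_r.
    rewrite (fcompA _ (D0 k) dq.1) -(fcompA _ dH.1); last exact: centered_comp.
    by rewrite H'H fcomp_id_l //; exact: centered_comp.
  have [q dq eq] := inv i; have [q' dq' eq'] := inv j.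
  exact: (contact_transport (gh0 i) (gh0 j) dq dq'.1 eq eq').
have t1 := formal_equivalence_tree_iso dF C0 G0 dphi E.
have t3 := tree_iso_sym_id (formal_equivalence_tree_iso dF' C0' G0' dphi' E').
have t2 : tree_iso (fun i => graph (g i)) (fun i => graph (g' i)) id.
  apply: same_contact_tree_iso => // i j n.
  rewrite (graph_path_feq _ (g0 i) (g0 j)) (graph_path_feq _ (g0' i) (g0' j)).
  rewrite -(contE _ _ _ _ C0 dF g0 dphi E).
  by rewrite -(contE _ _ _ _ C0' dF' g0' dphi' E').
exact: tree_iso_trans t1 (tree_iso_trans t2 t3).
Qed.

End SmoothBranches.

(** * Products of a branch and its conjugate *)

Section Equivalence.
Variables (K : numFieldType) (theta : {rmorphism K -> K}).
Hypothesis thetaK : involutive theta.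

(** The orders of contact of the branches are those of the product surfaces,
    which only depend on the surfaces up to diffeomorphism. *)
Lemma prod_equivalence_contact (Phi : fmap K 4 4) (s t s' t' : fmap K 2 1)
    (Psi Psi' : fmap K 2 2) d :
  centered s -> centered t -> centered s' -> centered t' ->
  formal_diffeo Psi -> formal_diffeo Psi' ->
  fcomp Phi (prod_map s (fmap_map theta s)) =
    fcomp (prod_map s' (fmap_map theta s')) Psi ->
  fcomp Phi (prod_map t (fmap_map theta t)) =
    fcomp (prod_map t' (fmap_map theta t')) Psi' ->
  contact d s t -> contact d s' t'.
Proof.
move=> s0 t0 s0' t0' dP dP' Es Et st.
have m0 (u : fmap K 2 1) : centered u -> centered (fmap_map theta u).
  exact: centered_map.
apply: (contact_fst (m0 _ s0') (m0 _ t0')).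
have [u0 v0] : centered (prod_map s (fmap_map theta s)) /\
    centered (prod_map t (fmap_map theta t)).
  by split; apply: centered_prod; rewrite //; apply: m0.
apply: (contact_transport u0 v0 dP dP'.1 Es Et).
exact: contact_prod st (contact_map theta st).
Qed.

Lemma prod_equivalence_inverse (Phi Phi' : fmap K 4 4) (S S' : fmap K 4 2)
    (Psi : fmap K 2 2) :
  formal_diffeo Phi -> centered S -> fcomp Phi' Phi = @fid K 4 -> formal_diffeo Psi ->
  fcomp Phi S = fcomp S' Psi ->
  exists2 Psi', formal_diffeo Psi' & fcomp Phi' S' = fcomp S Psi'.
Proof.
move=> dPhi S0 PP dPsi E; have [Psi' [dPsi' h _]] := formal_diffeo_inverse dPsi.
exists Psi'; first exact: dPsi'.
have -> : S' = fcomp (fcomp Phi S) Psi'.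
  by rewrite E (fcompA _ dPsi.1 dPsi'.1) h fcomp_id_r.
have T0 := centered_comp Psi' S0.
by rewrite (fcompA _ S0 dPsi'.1) -(fcompA Phi' dPhi.1 T0) PP (fcomp_id_l T0).
Qed.

Lemma prod_equivalence_tree_iso r (C C' : 'I_r -> fmap K 2 1)
    (Phi : fmap K 4 4) (Psi : 'I_r -> fmap K 2 2) :
  formal_diffeo Phi -> (forall i, formal_diffeo (Psi i)) ->
  (forall i, irreducible_param (C i)) -> (forall i, irreducible_param (C' i)) ->
  (forall i, fcomp Phi (prod_map (C i) (fmap_map theta (C i))) =
             fcomp (prod_map (C' i) (fmap_map theta (C' i))) (Psi i)) ->
  tree_iso C C' id.
Proof.
move=> dPhi dPsi irrC irrC' E.
have C0 i : centered (C i) by have [[]] := irrC i.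
have C0' i : centered (C' i) by have [[]] := irrC' i.
have m0 (u : fmap K 2 1) : centered u -> centered (fmap_map theta u).
  exact: centered_map.
have P0 (u : fmap K 2 1) : centered u -> centered (prod_map u (fmap_map theta u)).
  by move=> u0; apply: centered_prod => //; apply: m0.
case: (pselect (exists i, jacobian (C i) = 0)) => [[i0 J0]|smooth].
  have pC' i : param_curve (C' i) by have [] := irrC' i.
  have pD' i : param_curve (fmap_map theta (C' i)).
    split; first exact: m0.
    move=> h; apply: (pC' i).2 => k a; apply: (fmorph_inj theta).
    by rewrite rmorph0 -(h k a).
  have JD : jacobian (fmap_map theta (C i0)) = 0 by rewrite jacobian_map J0 map_mx0.
  have [F [dF [phi [dphi [EF|EF]]]]] := singular_component dPhi dPsi irrC
    (fun i => m0 _ (C0 i)) pC' pD' E J0 JD.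
    exact: formal_equivalence_tree_iso dF C0 C0' dphi EF.
  have t1 := formal_equivalence_tree_iso dF C0 (fun i => m0 _ (C0' i)) dphi EF.
  have t2 := tree_iso_sym_id (conjugation_tree_iso thetaK C').
  exact: tree_iso_trans t1 t2.
have [Phi' [dPhi' _ PP]] := formal_diffeo_inverse dPhi.
have inv i := prod_equivalence_inverse dPhi (P0 _ (C0 i)) PP (dPsi i) (E i).
apply: (smooth_tree_iso C0 C0').
- by move=> i; apply/eqP => h; apply: smooth; exists i.
- move=> i; apply/eqP => h'; apply: smooth; exists i.
  have h : jacobian (prod_map (C' i) (fmap_map theta (C' i))) = 0.
    by apply: jacobian_prod0; rewrite // jacobian_map h' map_mx0.
  apply: (jacobian_prod_eq0 (t := fmap_map theta (C i))); have [_ JPhi] := dPhi.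
  have := congr1 (@jacobian K 4 2) (E i).
  rewrite (jacobian_comp _ (P0 _ (C0 i))) (jacobian_comp _ (dPsi i).1) h mul0mx.
  by move=> /(congr1 (mulmx (invmx (jacobian Phi)))); rewrite mulKmx // mulmx0.
move=> i j d; split.
  exact: (prod_equivalence_contact (C0 i) (C0 j) (C0' i) (C0' j)
    (dPsi i) (dPsi j) (E i) (E j)).
have [Q dQ EQ] := inv i; have [Q' dQ' EQ'] := inv j.
exact: (prod_equivalence_contact (C0' i) (C0' j) (C0 i) (C0 j) dQ dQ' EQ EQ').
Qed.

End Equivalence.

Section Reindexing.
Variable K : fieldType.

Lemma reindexing_tree_iso r r' (C : 'I_r' -> fmap K 2 1) (b : 'I_r -> 'I_r') :
  bijective b -> tree_iso (fun i => C (b i)) C b.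
Proof.
move=> [b' bK bK'].
exists b', id, id; split=> //; first by split=> p q.
- apply: (carries_of_germs (R := fun _ x y => x = y) (can_inj bK) (@inj_id _)).
  + by move=> p x x' ->.
  + by move=> p x x' y y' -> ->.
  by move=> A p t h; exists t; split=> //; case: A h => [l|q].
apply: (carries_of_germs (R := fun _ x y => x = y) (can_inj bK') (@inj_id _)).
- by move=> p x x' ->.
- by move=> p x x' y y' -> ->.
by move=> A p t h; exists t; split=> //; case: A h => [l|q] //; rewrite /germ_at /= bK'.
Qed.

End Reindexing.

(** * Complexification *)

Lemma fps_map_conj_coord (K : fieldType) (theta : {rmorphism K -> K}) (c : K) :
  theta c = - c ->
  fps_map theta (fX 0 + fC c * fX 1 : fps K 2) = fX 0 - fC c * fX 1.
Proof.
move=> h; rewrite fps_mapD fps_mapM !fps_mapX fps_mapC h -mulNr.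
by rewrite /fC mpolyCN raddfN.
Qed.

Section Complexification.
Variable R : realType.
Local Notation K := (R[i]%C).

Let iota : {rmorphism R -> K} := real_complex R.
Let theta : {rmorphism K -> K} := @conjc R.

Lemma conjugation_involutive : involutive theta.
Proof. exact: conjcK. Qed.

Lemma formal_diffeo_complexify n (F : fmap R n n) :
  formal_diffeo F -> formal_diffeo (fmap_map iota F).
Proof.
by move=> [F0 JF]; split; [exact: centered_map|rewrite jacobian_map map_unitmx].
Qed.

(** The complex coordinates [(x1 + i y1, x2 + i y2, x1 - i y1, x2 - i y2)] on
    the complexification of [R^4], which turn the surface underlying [s] into
    the product of [s] and its conjugate. *)
Definition complex_coords : fmap K 4 4 := pair_map
  (fun j => fX (lshift 2 j) + fC 'i%C * fX (rshift 2 j))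
  (fun j => fX (lshift 2 j) - fC 'i%C * fX (rshift 2 j)).

Definition real_coords : fmap K 4 4 := pair_map
  (fun j => fC 2%:R^-1 * (fX (lshift 2 j) + fX (rshift 2 j)))
  (fun j => fC (2%:R^-1 * - 'i%C) * (fX (lshift 2 j) - fX (rshift 2 j))).

Lemma complex_coordsE n (S : fmap K 4 n) : centered S ->
  fcomp complex_coords S = pair_map
    (fun j => S (lshift 2 j) + fC 'i%C * S (rshift 2 j))
    (fun j => S (lshift 2 j) - fC 'i%C * S (rshift 2 j)).
Proof.
move=> S0; rewrite fcomp_pair; congr pair_map; apply: funext => j; rewrite /fcomp.
  by rewrite substD (substM S0) !(substX S0) (substC S0).
by rewrite substB (substM S0) !(substX S0) (substC S0).
Qed.

Lemma formal_diffeo_complex_coords : formal_diffeo complex_coords.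
Proof.
have r0 : centered real_coords.
  by apply: centered_pair => j;
     rewrite !(coeffsD, coeffsN, coeffs0M, coeffsX, mnm1_eq0, mulr0n, oppr0, addr0, mulr0).
have c0 : centered complex_coords.
  by apply: centered_pair => j;
     rewrite !(coeffsD, coeffsN, coeffs0M, coeffsX, mnm1_eq0, mulr0n, oppr0, addr0, mulr0).
apply: (proj1 (diffeo_of_inverse c0 r0 _)).
rewrite (complex_coordsE r0).
have fst_r (j : 'I_2) : real_coords (lshift 2 j) =
    fC 2%:R^-1 * (fX (lshift 2 j) + fX (rshift 2 j)).
  by rewrite /real_coords -/(fst_map _ j) fst_pair.
have snd_r (j : 'I_2) : real_coords (rshift 2 j) =
    fC (2%:R^-1 * - 'i%C) * (fX (lshift 2 j) - fX (rshift 2 j)).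
  by rewrite /real_coords -/(snd_map _ j) snd_pair.
have half : fC 2%:R^-1 * (1 + 1) = 1 :> fps K 4.
  rewrite -fC1 -rmorphD -rmorphM /= -mpolyCD -mpolyCM.
  by rewrite -[1 + 1 in LHS]/(2%:R) mulVf ?pnatr_eq0 //.
have ihalf : fC 'i%C * fC (2%:R^-1 * - 'i%C) = fC 2%:R^-1 :> fps K 4.
  by rewrite -rmorphM /= -mpolyCM mulrCA mulrN -expr2 sqr_i opprK mulr1.
rewrite [RHS]pair_mapE; congr pair_map; apply: funext => j.
  rewrite fst_r snd_r mulrA ihalf -mulrDr /fst_map /fid.
  rewrite (_ : _ + _ = (1 + 1) * fX (lshift 2 j)); last by ring.
  by rewrite mulrA half mul1r.
rewrite fst_r snd_r mulrA ihalf -mulrBr /snd_map /fid.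
rewrite (_ : _ - _ = (1 + 1) * fX (rshift 2 j)); last by ring.
by rewrite mulrA half mul1r.
Qed.

Lemma complex_coords_realify n (S : fmap K 2 n) : centered S ->
  fcomp complex_coords (fmap_map iota (realify S)) =
  pair_map S (fmap_map theta S).
Proof.
move=> S0; have r0 : centered (fmap_map iota (realify S)).
  apply: centered_map => k; rewrite /realify; case: (split _) => j;
    by rewrite S0 // raddf0.
rewrite (complex_coordsE r0).
have re (j : 'I_2) a : fmap_map iota (realify S) (lshift 2 j) a = (complex.Re (S j a))%:C%C.
  by rewrite /fmap_map /fps_map /realify (unsplitK (inl _ j)).
have im (j : 'I_2) a : fmap_map iota (realify S) (rshift 2 j) a = (complex.Im (S j a))%:C%C.
  by rewrite /fmap_map /fps_map /realify (unsplitK (inr _ j)).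
congr pair_map; apply: funext => j; apply: fpsP => a.
  by rewrite coeffsD coeffsCM re im -complexE.
rewrite coeffsB coeffsCM re im /fmap_map /fps_map.
by rewrite [in RHS](complexE (S j a)) rmorphD rmorphM /=; simpc.
Qed.

Definition conj_coords : fmap K 2 2 := fun k =>
  if k == 0 then fX 0 + fC 'i%C * fX 1 else fX 0 - fC 'i%C * fX 1.

Lemma formal_diffeo_conj_coords : formal_diffeo conj_coords.
Proof.
split.
  by move=> k; rewrite /conj_coords; case: ifP => _;
     rewrite !(coeffsD, coeffsN, coeffs0M, coeffsX, mnm1_eq0, mulr0n, oppr0, addr0, mulr0).
have ne : (U_(0%R) == U_(1%R) :> 'X_{1..2})%MM = false.
  by apply/negP => /eqP/mnmP/(_ 0); rewrite !mnm1E.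
rewrite unitmxE det_mx2 !mxE /conj_coords /= !coeffsD !coeffsCM ?coeffsN ?coeffsCM !coeffsX.
have ne' : (U_(1%R) == U_(0%R) :> 'X_{1..2})%MM = false by rewrite eq_sym.
rewrite !eqxx ne ne' !mulr0n !mulr1n !mulr0 !mulr1 ?subr0 ?addr0 ?add0r ?sub0r.
rewrite mul1r mulr1 -opprD unitfE oppr_eq0 -mulr2n mulrn_eq0 /=.
by rewrite neq0Ci.
Qed.

Lemma real_surface_coords (s : fmap K 2 1) : centered s ->
  fcomp complex_coords (fmap_map iota (real_surface s)) =
  fcomp (prod_map s (fmap_map theta s)) conj_coords.
Proof.
move=> s0; have xE : @x_plus_iy R = fun _ => conj_coords 0.
  apply: funext => l; rewrite /x_plus_iy /conj_coords /= rmorphD -mul_mpolyC.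
  by rewrite rmorphM.
rewrite complex_coords_realify; last exact: centered_comp.
rewrite (prod_comp _ _ formal_diffeo_conj_coords.1) fmap_map_comp xE.
congr (pair_map _ (fcomp _ _)); apply: funext => l.
by apply: fps_map_conj_coord; rewrite /=; simpc.
Qed.

Lemma complexify_equivalence (Phi : fmap R 4 4) : formal_diffeo Phi ->
  exists2 Phi' : fmap K 4 4, formal_diffeo Phi' &
    forall s s' : fmap K 2 1, centered s -> centered s' ->
      real_equiv_param Phi s s' ->
      exists2 Psi : fmap K 2 2, formal_diffeo Psi &
        fcomp Phi' (prod_map s (fmap_map theta s)) =
        fcomp (prod_map s' (fmap_map theta s')) Psi.
Proof.
move=> dPhi; have dQ := formal_diffeo_complex_coords.
have [P [dP QP PQ]] := formal_diffeo_inverse dQ.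
have dPhiC := formal_diffeo_complexify dPhi.
have dPP : formal_diffeo (fcomp (fmap_map iota Phi) P) by apply: formal_diffeo_comp.
exists (fcomp complex_coords (fcomp (fmap_map iota Phi) P)).
  exact: formal_diffeo_comp.
move=> s s' s0 s0' [Psi [dPsi E]].
have dZ := formal_diffeo_conj_coords; have [Z' [dZ' ZZ' _]] := formal_diffeo_inverse dZ.
have dPsiC := formal_diffeo_complexify dPsi.
have dPZ := formal_diffeo_comp dPsiC dZ'.
exists (fcomp conj_coords (fcomp (fmap_map iota Psi) Z')).
  exact: formal_diffeo_comp dZ dPZ.
have m0 (u : fmap K 2 1) : centered u -> centered (fmap_map theta u).
  exact: centered_map.
have S0 := centered_prod s0 (m0 _ s0).
have rs0 (u : fmap K 2 1) : centered u -> centered (fmap_map iota (real_surface u)).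
  move=> u0; apply: centered_map => k; rewrite /real_surface /realify.
  by case: (split _) => j; rewrite (centered_comp _ u0) // raddf0.
have EC := congr1 (@fmap_map _ _ iota 4 2) (fmapP E); rewrite !fmap_map_comp in EC.
set S := prod_map s _; set S' := prod_map s' _.
have SZ : fcomp P (fcomp S conj_coords) = fmap_map iota (real_surface s).
  rewrite -(real_surface_coords s0) -(fcompA P dQ.1 (rs0 _ s0)) PQ.
  by rewrite fcomp_id_l //; apply: rs0.
have SE : S = fcomp (fcomp S conj_coords) Z'.
  by rewrite (fcompA S dZ.1 dZ'.1) ZZ' fcomp_id_r.
have SZ0 : centered (fcomp S conj_coords) by apply: centered_comp.
have e1 : fcomp (fcomp complex_coords (fcomp (fmap_map iota Phi) P)) (fcomp S conj_coords) =
    fcomp S' (fcomp conj_coords (fmap_map iota Psi)).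
  rewrite (fcompA complex_coords dPP.1 SZ0) (fcompA _ dP.1 SZ0) SZ.
  rewrite [X in fcomp complex_coords X]EC.
  rewrite -(fcompA complex_coords (rs0 _ s0') dPsiC.1) (real_surface_coords s0').
  exact: (fcompA _ dZ.1 dPsiC.1).
rewrite {1}SE -(fcompA _ SZ0 dZ'.1) e1.
apply: (etrans (fcompA S' (centered_comp _ dZ.1) dZ'.1)).
exact/(congr1 (fcomp S'))/(fcompA conj_coords dPsiC.1 dZ'.1).
Qed.

End Complexification.

Theorem theorem7p2 (R : realType) (Phi : fmap R 4 4) (f f' : fps R[i] 2)
    (hPhi : formal_diffeo Phi)
    (hf : reduced_curve f) (hf' : reduced_curve f')
    (hequiv : formal_real_equivalence Phi f f') :
  equisingular f f'.
Proof.
have [r [C [r' [C' [b [cC cC' bb E]]]]]] := hequiv.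
have irrC i : irreducible_param (C i) by have [h _ _] := cC; have [] := h i.
have irrC' i : irreducible_param (C' i) by have [h _ _] := cC'; have [] := h i.
exists r, C, r', C'; split=> //.
have [Phi' dPhi' hPhi'] := complexify_equivalence hPhi.
have C0 i : centered (C i) by have [[]] := irrC i.
have C0' i : centered (C' i) by have [[]] := irrC' i.
have [Psi hPsi] := choice (fun i => let: ex_intro2 P dP eP :=
   hPhi' _ _ (C0 i) (C0' (b i)) (E i) in ex_intro _ P (conj dP eP)).
have t1 := prod_equivalence_tree_iso (@conjugation_involutive R) dPhi'
  (fun i => (hPsi i).1) irrC (fun i => irrC' (b i)) (fun i => (hPsi i).2).
exact: tree_iso_combinatorial (tree_iso_trans t1 (reindexing_tree_iso C' bb)).
Qed.
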